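(* Let $\bar M^{2n+1}(f_1,f_2,f_3)$, $n>1$, be a generalized Sasakian-space-form with structure $(\phi,\xi,\eta,g)$ and Levi-Civita connection $\bar\nabla$ satisfying the standing identities for $\bar\nabla\phi$ and $\bar\nabla\xi$ listed in the context, and let $\tilde{\bar\nabla}$ be the semisymmetric metric connection $\tilde{\bar\nabla}_XY=\bar\nabla_XY+\eta(Y)X-g(X,Y)\xi$. Let $M$ be an $(m+1)$-dimensional almost semi-invariant submanifold of $\bar M^{2n+1}(f_1,f_2,f_3)$ which is minimal with respect to $\tilde{\bar\nabla}$, i.e. $\tilde H=0$. Then: (i) for every vector field $X$ tangent to $M$, $$\tilde S(X,X)\le\sum_{\lambda}(mf_1+3f_2\lambda^2-f_3+1)\,g(U^\lambda X,U^\lambda X)+m(f_1-f_3+1)\,\eta(X)\eta(X)+(f_1-f_3)(m-1)\,g(TX,X);$$ (ii) $$\tilde\tau\le f_1+\frac{1}{m(m+1)}\Big\{3f_2\sum_{\lambda}n(\lambda)\lambda^2-2m(f_3-1)\Big\}.$$ Here $\tilde S$ and $\tilde\tau$ are the Ricci tensor and the (normalized) scalar curvature of the connection $\tilde\nabla$ induced on $M$ by $\tilde{\bar\nabla}$, and $\lambda$ runs over $\{1,0,\lambda_1,\dots,\lambda_l\}$.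
   Context: **Ambient space.** An almost contact metric manifold $\bar M(\phi,\xi,\eta,g)$ satisfies $\phi^2X=-X+\eta(X)\xi$, $\phi\xi=0$, $\eta(\xi)=1$, $g(X,\xi)=\eta(X)$, $\eta(\phi X)=0$, $g(\phi X,\phi Y)=g(X,Y)-\eta(X)\eta(Y)$, $g(\phi X,Y)=-g(X,\phi Y)$. The curvature of a connection $D$ is $R(X,Y)Z=D_XD_YZ-D_YD_XZ-D_{[X,Y]}Z$. A generalized Sasakian-space-form $\bar M^{2n+1}(f_1,f_2,f_3)$ is an almost contact metric manifold of dimension $2n+1$ (with $n>1$) together with smooth functions $f_1,f_2,f_3$ such that the curvature of the Levi-Civita connection $\bar\nabla$ is $$\bar R(X,Y)Z=f_1\{g(Y,Z)X-g(X,Z)Y\}+f_2\{g(X,\phi Z)\phi Y-g(Y,\phi Z)\phi X+2g(X,\phi Y)\phi Z\}+f_3\{\eta(X)\eta(Z)Y-\eta(Y)\eta(Z)X+g(X,Z)\eta(Y)\xi-g(Y,Z)\eta(X)\xi\}.$$ Standing identities, used throughout for $\bar M^{2n+1}(f_1,f_2,f_3)$: $$(\bar\nabla_X\phi)(Y)=(f_1-f_3)[g(X,Y)\xi-\eta(Y)X],\qquad \bar\nabla_X\xi=-(f_1-f_3)\phi X.$$ **Submanifold.** $M$ is a submanifold of dimension $m+1$ ($m\ge 1$) with $\xi$ tangent to $M$ and the induced metric $g$. For $X$ tangent to $M$ write $\phi X=TX+FX$ with $TX$ tangent and $FX$ normal. Let $D$ be the orthogonal complement of $\xi$ in $TM$.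 $M$ is almost semi-invariant if there exist $l$ functions $\lambda_1,\dots,\lambda_l$ on $M$ with values in $(0,1)$ such that (a) at each $p\in M$, $-\lambda_1^2(p),\dots,-\lambda_l^2(p)$ are distinct eigenvalues of $T^2|_D$ and $T_pM=D^1_p\oplus D^0_p\oplus D^{\lambda_1}_p\oplus\cdots\oplus D^{\lambda_l}_p\oplus\mathrm{span}\{\xi_p\}$, where $D^\lambda_p$, $\lambda\in\{1,0,\lambda_1(p),\dots,\lambda_l(p)\}$, is the eigenspace of $T^2|_D$ for the eigenvalue $-\lambda^2$; (b) the dimensions of $D^1_p,D^0_p,D^{\lambda_1}_p,\dots,D^{\lambda_l}_p$ do not depend on $p$. $U^\lambda$ is the orthogonal projection $TM\to D^\lambda$ and $n(\lambda)=\dim D^\lambda$. Sums $\sum_\lambda$ run over $\lambda\in\{1,0,\lambda_1,\dots,\lambda_l\}$. **Induced objects.** For $X,Y$ tangent to $M$, $\tilde{\bar\nabla}_XY=\tilde\nabla_XY+\tilde h(X,Y)$ is the decomposition into tangential and normal parts; $\tilde\nabla$ is the induced connection and $\tilde h$ the second fundamental form with respect to it. Let $\tilde R$ be the curvature of $\tilde\nabla$ and $\tilde R(X,Y,Z,W)=g(\tilde R(X,Y)Z,W)$. For a local orthonormal frame $\{E_1,\dots,E_{m+1}\}$ of $TM$ with $E_{m+1}=\xi$: $\tilde H=\frac1{m+1}\sum_i\tilde h(E_i,E_i)$, $\tilde S(X,Y)=\sum_{i=1}^{m+1}\tilde R(X,E_i,E_i,Y)$, and $\tilde\tau=\frac{1}{m(m+1)}\sum_{i,j=1}^{m+1}\tilde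 R(E_i,E_j,E_j,E_i)$. *)

(* Defs.v *)
From HB Require Import structures.
From mathcomp Require Import all_boot all_order all_algebra.
From mathcomp Require Import all_classical all_reals all_analysis.
Import Order.TTheory GRing.Theory Num.Theory.
Import numFieldNormedType.Exports.

Set Implicit Arguments.
Unset Strict Implicit.
Unset Printing Implicit Defensive.

Local Open Scope classical_set_scope.
Local Open Scope ring_scope.

(* Vectors are row vectors and matrices act on them from the right, as in
   MathComp's [jacobian]. *)

Section Smoothness.
Variables (R : realType) (d : nat) (V : normedModType R).

Definition partial (j : 'I_d) (f : 'rV[R]_d -> V) : 'rV[R]_d -> V :=
  fun x => 'D_(delta_mx 0 j : 'rV[R]_d) f x.

(* C^oo near x: all iterated partial derivatives are Frechet differentiable
   (hence continuous) on a neighbourhood of x. *)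
Definition smooth_at (f : 'rV[R]_d -> V) (x : 'rV[R]_d) : Prop :=
  \forall y \near x, forall s : seq 'I_d,
    differentiable (foldr partial f s) y.

End Smoothness.

(* A smooth manifold of dimension d, given by a smooth atlas indexed by
   [chart]; [cinv c] is only meaningful on the image of [cmap c].
   [chart_at p] is a preferred chart around p. *)
Record manifold (R : realType) (d : nat) := Manifold {
  carrier :> topologicalType;
  chart : Type;
  cdom : chart -> set carrier;
  cmap : chart -> carrier -> 'rV[R]_d;
  cinv : chart -> 'rV[R]_d -> carrier;
  chart_at : carrier -> chart;
  manifold_hausdorff : hausdorff_space carrier;
  manifold_second_countable : @second_countable carrier;
  cdom_chart_at : forall p, cdom (chart_at p) p;
  cdom_open : forall c, open (cdom c);
  cimage_open : forall c, open (cmap c @` cdom c);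
  cmapK : forall c p, cdom c p -> cinv c (cmap c p) = p;
  cmap_continuous : forall c p, cdom c p -> {for p, continuous (cmap c)};
  cinv_continuous : forall c p, cdom c p ->
    {for cmap c p, continuous (cinv c)};
  transition_smooth : forall c c' p, cdom c p -> cdom c' p ->
    smooth_at (cmap c' \o cinv c) (cmap c p)
}.

Arguments cdom {R d m} c _.
Arguments cmap {R d m} c _.
Arguments cinv {R d m} c _.
Arguments chart_at {R d m} p.

Section TangentBundle.
Variables (R : realType) (d : nat) (N : manifold R d).

(* The tangent space at p is 'rV_d: a tangent vector at p is represented by
   its components in the chart [chart_at p].  A vector field is thus a
   function N -> 'rV_d, and the metric and (1,1)-tensors are functions
   N -> 'M_d.  The value at p of such a function is read in [chart_at p],
   which varies with p: smoothness and derivatives of vector fields must be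
   taken on the components in one fixed chart ([tcoord]). *)

Definition transition_jacobian (c c' : chart N) (p : N) : 'M[R]_d :=
  jacobian (cmap c' \o cinv c) (cmap c p).

Definition tcoord (c : chart N) (p : N) (v : 'rV[R]_d) : 'rV[R]_d :=
  v *m transition_jacobian (chart_at p) c p.

Definition coord_field (c : chart N) (j : 'I_d) : N -> 'rV[R]_d :=
  fun p => delta_mx 0 j *m transition_jacobian c (chart_at p) p.

Definition msmooth_at (V : normedModType R) (F : N -> V) (p : N) : Prop :=
  smooth_at (F \o cinv (chart_at p)) (cmap (chart_at p) p).

Definition vsmooth_at (X : N -> 'rV[R]_d) (p : N) : Prop :=
  msmooth_at (fun q => tcoord (chart_at p) q (X q)) p.

Definition mderiv (V : normedModType R) (F : N -> V) (p : N) (v : 'rV[R]_d)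
    : V :=
  'd (F \o cinv (chart_at p)) (cmap (chart_at p) p) v.

Definition lie_bracket (X Y : N -> 'rV[R]_d) : N -> 'rV[R]_d := fun p =>
  mderiv (fun q => tcoord (chart_at p) q (Y q)) p (X p)
  - mderiv (fun q => tcoord (chart_at p) q (X q)) p (Y p).

(* Covariant derivative operators: [D Y p v] stands for (D_v Y)(p), where v
   is a tangent vector at p and Y a vector field smooth near p. *)
Definition cov_op := (N -> 'rV[R]_d) -> forall p : N, 'rV[R]_d -> 'rV[R]_d.

(* The laws are required of all locally defined fields (smooth near p).  They
   entail locality: multiply by the indicator of a neighbourhood of p. *)
Record connection (D : cov_op) : Prop := {
  conn_linear : forall Y p a v w, vsmooth_at Y p ->
    D Y p (a *: v + w) = a *: D Y p v + D Y p w;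
  conn_add : forall Y Z p v, vsmooth_at Y p -> vsmooth_at Z p ->
    D (fun q => Y q + Z q) p v = D Y p v + D Z p v;
  conn_leibniz : forall (f : N -> R) Y p v,
    msmooth_at f p -> vsmooth_at Y p ->
    D (fun q => f q *: Y q) p v = mderiv f p v *: Y p + f p *: D Y p v;
  conn_smooth : forall X Y p, vsmooth_at X p -> vsmooth_at Y p ->
    vsmooth_at (fun q => D Y q (X q)) p
}.

Definition curvature (D : cov_op) (X Y Z : N -> 'rV[R]_d) : N -> 'rV[R]_d :=
  fun p =>
    D (fun q => D Z q (Y q)) p (X p) - D (fun q => D Z q (X q)) p (Y p)
    - D Z p (lie_bracket X Y p).

Definition pairing (g : N -> 'M[R]_d) (p : N) (v w : 'rV[R]_d) : R :=
  (v *m g p *m w^T) 0 0.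

Record riemannian_metric (g : N -> 'M[R]_d) : Prop := {
  metric_sym : forall p v w, pairing g p v w = pairing g p w v;
  metric_pos : forall p v, v != 0 -> 0 < pairing g p v v;
  metric_smooth : forall p X Y, vsmooth_at X p -> vsmooth_at Y p ->
    msmooth_at (fun q => pairing g q (X q) (Y q)) p
}.

Record levi_civita (g : N -> 'M[R]_d) (D : cov_op) : Prop := {
  lc_connection : connection D;
  lc_torsion_free : forall X Y p, vsmooth_at X p -> vsmooth_at Y p ->
    D Y p (X p) - D X p (Y p) = lie_bracket X Y p;
  lc_metric : forall Y Z p v, vsmooth_at Y p -> vsmooth_at Z p ->
    mderiv (fun q => pairing g q (Y q) (Z q)) p v
    = pairing g p (D Y p v) (Z p) + pairing g p (Y p) (D Z p v)
}.

(* Almost contact metric structures (phi, xi, eta, g). *)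
Record acm_structure := AcmStructure {
  acm_phi : N -> 'M[R]_d;
  acm_xi : N -> 'rV[R]_d;
  acm_eta : N -> 'cV[R]_d;
  acm_g : N -> 'M[R]_d
}.

Variable S : acm_structure.

Definition phi (p : N) (v : 'rV[R]_d) : 'rV[R]_d := v *m acm_phi S p.
Definition xi (p : N) : 'rV[R]_d := acm_xi S p.
Definition eta (p : N) (v : 'rV[R]_d) : R := (v *m acm_eta S p) 0 0.
Definition gm (p : N) (v w : 'rV[R]_d) : R := pairing (acm_g S) p v w.

Record almost_contact_metric : Prop := {
  acm_metric : riemannian_metric (acm_g S);
  acm_phi_smooth : forall p X, vsmooth_at X p ->
    vsmooth_at (fun q => phi q (X q)) p;
  acm_xi_smooth : forall p, vsmooth_at xi p;
  acm_eta_smooth : forall p X, vsmooth_at X p ->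
    msmooth_at (fun q => eta q (X q)) p;
  acm_phi_phi : forall p v, phi p (phi p v) = - v + eta p v *: xi p;
  acm_phi_xi : forall p, phi p (xi p) = 0;
  acm_eta_xi : forall p, eta p (xi p) = 1;
  acm_g_xi : forall p v, gm p v (xi p) = eta p v;
  acm_eta_phi : forall p v, eta p (phi p v) = 0;
  acm_g_phi_phi : forall p v w,
    gm p (phi p v) (phi p w) = gm p v w - eta p v * eta p w;
  acm_g_phi : forall p v w, gm p (phi p v) w = - gm p v (phi p w)
}.

Record gen_sasakian_space_form (f1 f2 f3 : N -> R) (D : cov_op) : Prop := {
  gssf_acm : almost_contact_metric;
  gssf_lc : levi_civita (acm_g S) D;
  gssf_f1_smooth : forall p, msmooth_at f1 p;
  gssf_f2_smooth : forall p, msmooth_at f2 p;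
  gssf_f3_smooth : forall p, msmooth_at f3 p;
  gssf_curvature : forall X Y Z p,
    vsmooth_at X p -> vsmooth_at Y p -> vsmooth_at Z p ->
    curvature D X Y Z p =
      let x := X p in let y := Y p in let z := Z p in
      f1 p *: (gm p y z *: x - gm p x z *: y)
      + f2 p *: (gm p x (phi p z) *: phi p y - gm p y (phi p z) *: phi p x
                 + (2 * gm p x (phi p y)) *: phi p z)
      + f3 p *: ((eta p x * eta p z) *: y - (eta p y * eta p z) *: x
                 + (gm p x z * eta p y) *: xi p
                 - (gm p y z * eta p x) *: xi p)
}.

Record standing_identities (f1 f3 : N -> R) (D : cov_op) : Prop := {
  nabla_phi : forall Y p v, vsmooth_at Y p ->
    D (fun q => phi q (Y q)) p v - phi p (D Y p v)
    = (f1 p - f3 p) *: (gm p v (Y p) *: xi p - eta p (Y p) *: v);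
  nabla_xi : forall p v, D xi p v = - ((f1 p - f3 p) *: phi p v)
}.

Definition semisym_metric_conn (D : cov_op) : cov_op :=
  fun Y p v => D Y p v + eta p (Y p) *: v - gm p v (Y p) *: xi p.

End TangentBundle.

(* For a Gram matrix G and a matrix B with independent rows, [orth_coord G B]
   sends w to the coefficients u such that u *m B is the G-orthogonal
   projection of w onto the row space of B; it solves
   (w - u *m B) *m G *m B^T = 0. *)
Definition orth_coord (R : realType) (d k : nat) (G : 'M[R]_d)
    (B : 'M[R]_(k, d)) : 'M[R]_(d, k) :=
  G *m B^T *m invmx (B *m G *m B^T).

(* Matrix of the G-orthogonal projection onto the row space of A. *)
Definition orth_projection (R : realType) (d k : nat) (G : 'M[R]_d)
    (A : 'M[R]_(k, d)) : 'M[R]_d :=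
  orth_coord G (row_base A) *m row_base A.

Section Submanifold.
Variables (R : realType) (d k : nat) (N : manifold R d) (M : manifold R k).
Variable i : M -> N.

(* The map i read in the preferred charts, and the matrix of its tangent map
   T_p M -> T_(i p) N. *)
Definition local_expr (p : M) : 'rV[R]_k -> 'rV[R]_d :=
  cmap (chart_at (i p)) \o i \o cinv (chart_at p).

Definition tangent_mx (p : M) : 'M[R]_(k, d) :=
  jacobian (local_expr p) (cmap (chart_at p) p).

Definition tmap (p : M) (v : 'rV[R]_k) : 'rV[R]_d := v *m tangent_mx p.

Record immersion : Prop := {
  imm_continuous : continuous i;
  imm_smooth : forall p, smooth_at (local_expr p) (cmap (chart_at p) p);
  imm_injective : forall p, injective (tmap p)
}.

(* Covariant derivative in the direction v of T_p M of a vector field Z of N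
   along i (Z q is tangent to N at i q).  Writing Z = \sum_j Z^j d_j in the
   chart c around i p, this is \sum_j (v Z^j) d_j + Z^j D_(i_* v) d_j. *)
Definition pullback_cov (D : cov_op N) (Z : M -> 'rV[R]_d) (p : M)
    (v : 'rV[R]_k) : 'rV[R]_d :=
  let c := chart_at (i p) in
  mderiv (fun q => tcoord c (i q) (Z q)) p v
  + \sum_(j < d) (Z p) 0 j *: D (coord_field c j) (i p) (tmap p v).

Variable S : acm_structure N.

Definition induced_metric (p : M) : 'M[R]_k :=
  tangent_mx p *m acm_g S (i p) *m (tangent_mx p)^T.

Definition gM (p : M) (v w : 'rV[R]_k) : R := pairing induced_metric p v w.

(* Tangential part of w in T_(i p) N, as an element of T_p M. *)
Definition tan_part (p : M) (w : 'rV[R]_d) : 'rV[R]_k :=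
  w *m orth_coord (acm_g S (i p)) (tangent_mx p).

Definition induced_conn (D : cov_op N) : cov_op M := fun Y p v =>
  tan_part p (pullback_cov D (fun q => tmap q (Y q)) p v).

Definition second_ff (D : cov_op N) (Y : M -> 'rV[R]_k) (p : M)
    (v : 'rV[R]_k) : 'rV[R]_d :=
  pullback_cov D (fun q => tmap q (Y q)) p v - tmap p (induced_conn D Y p v).

Definition xi_tangent : Prop :=
  forall p, exists v, tmap p v = xi S (i p).

Definition xiM (p : M) : 'rV[R]_k := tan_part p (xi S (i p)).
Definition etaM (p : M) (v : 'rV[R]_k) : R := eta S (i p) (tmap p v).

(* phi X = T X + F X with T X tangent and F X normal. *)
Definition T_mx (p : M) : 'M[R]_k :=
  tangent_mx p *m acm_phi S (i p)
  *m orth_coord (acm_g S (i p)) (tangent_mx p).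

(* Row space: the orthogonal complement of xi in T_p M. *)
Definition contact_dist (p : M) : 'M[R]_k :=
  kermx (induced_metric p *m (xiM p)^T).

(* Row space: the eigenspace of T^2 restricted to [contact_dist p] for the
   eigenvalue - x ^ 2. *)
Definition eigen_dist (p : M) (x : R) : 'M[R]_k :=
  (contact_dist p :&: eigenspace (T_mx p *m T_mx p) (- x ^+ 2))%MS.

(* The labels 1, 0, lambda_1, ..., lambda_l. *)
Definition label_val (l : nat) (lam : 'I_l -> M -> R) (a : bool + 'I_l)
    (p : M) : R :=
  match a with inl b => b%:R | inr j => lam j p end.

Definition dist (l : nat) (lam : 'I_l -> M -> R) (a : bool + 'I_l) (p : M)
    : 'M[R]_k :=
  eigen_dist p (label_val lam a p).

Definition U_proj (l : nat) (lam : 'I_l -> M -> R) (a : bool + 'I_l) (p : M)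
    (v : 'rV[R]_k) : 'rV[R]_k :=
  v *m orth_projection (induced_metric p) (dist lam a p).

Record almost_semi_invariant (l : nat) (lam : 'I_l -> M -> R) : Prop := {
  asi_xi : xi_tangent;
  asi_range : forall j p, 0 < lam j p < 1;
  asi_eigenvalue : forall j p, dist lam (inr j) p != 0;
  asi_distinct : forall p, injective (fun j => - lam j p ^+ 2);
  asi_direct : forall p,
    mxdirect ((\sum_(a : bool + 'I_l) dist lam a p) + xiM p);
  asi_span : forall p,
    ((\sum_(a : bool + 'I_l) dist lam a p) + xiM p == 1%:M)%MS;
  asi_const_rank : forall a p q, \rank (dist lam a p) = \rank (dist lam a q)
}.

End Submanifold.

Section Traces.
Variables (R : realType) (d m : nat) (N : manifold R d).
Variables (M : manifold R m.+1) (i : M -> N) (S : acm_structure N).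

(* Orthonormal frame of TM on a neighbourhood of p whose last field is xi. *)
Record local_frame (E : 'I_m.+1 -> M -> 'rV[R]_m.+1) (p : M) : Prop := {
  frame_smooth : forall a, vsmooth_at (E a) p;
  frame_orthonormal : \forall q \near p, forall a b,
    gM i S q (E a q) (E b q) = (a == b)%:R;
  frame_xi : \forall q \near p, tmap i q (E ord_max q) = xi S (i q)
}.

Variable D : cov_op N.
Variable E : 'I_m.+1 -> M -> 'rV[R]_m.+1.

Definition curvature4 (X Y Z W : M -> 'rV[R]_m.+1) (p : M) : R :=
  gM i S p (curvature (induced_conn i S D) X Y Z p) (W p).

Definition mean_curvature (p : M) : 'rV[R]_d :=
  (m.+1%:R)^-1 *: \sum_(a < m.+1) second_ff i S D (E a) p (E a p).

Definition ricci (X Y : M -> 'rV[R]_m.+1) (p : M) : R :=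
  \sum_(a < m.+1) curvature4 X (E a) (E a) Y p.

Definition scalar_curvature (p : M) : R :=
  ((m * m.+1)%:R)^-1 *
  \sum_(a < m.+1) \sum_(b < m.+1) curvature4 (E a) (E b) (E b) (E a) p.

End Traces.

(* Vanishing mean curvature; it is computed in arbitrary adapted frames. *)
Definition minimal (R : realType) (d m : nat) (N : manifold R d)
    (M : manifold R m.+1) (i : M -> N) (S : acm_structure N) (D : cov_op N)
    : Prop :=
  forall p E, local_frame i S E p -> mean_curvature i S D E p = 0.

(* Main.v *)
From HB Require Import structures.
From mathcomp Require Import all_boot all_order all_algebra.
From mathcomp Require Import all_classical all_reals all_analysis.
From mathcomp Require Import ring lra.
Require Import Defs.
Import Order.TTheory GRing.Theory Num.Theory.
Import numFieldNormedType.Exports.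
Set Implicit Arguments.
Unset Strict Implicit.
Unset Printing Implicit Defensive.
Local Open Scope classical_set_scope.
Local Open Scope ring_scope.

(** Let [D] be the Levi-Civita connection of the ambient manifold, [D~] the
    semisymmetric metric connection and [h] the second fundamental form of the
    submanifold for [D~].  Write [k = f1 - f3].

    The Gauss equation holds for [D~] as it does for [D]: [D~] is metric
    ([is_mdiff_gm_semisym]), and its torsion [eta(Y) X - eta(X) Y] is tangent
    to the submanifold, so that [h] is symmetric ([second_ff_sym]).  Hence
    ([gauss_equation])
      g(R(X,Y)Z, W) = g(R~(X,Y)Z, W) + g(h(Y,Z), h(X,W)) - g(h(X,Z), h(Y,W)),
    where [R] is the curvature of the induced connection and [R~] that of [D~].
    For [Y = Z = E_a] and [W = X], summed over an orthonormal frame, the second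
    term vanishes by minimality and the third one is minus a sum of squares.
    So the Ricci curvature is at most the trace of [R~] ([ricci_le]).

    That trace is explicit.  Expanding [D~] gives [R~] as the curvature tensor
    of the space form plus terms in [g], [eta], [xi] and [D xi = - k phi]
    ([semisym_curvature]); its trace over the frame is
      (m f1 - f3 - (m-1)) |X|^2 + 3 f2 |TX|^2 + (m-1)(1 - f3) eta(X)^2
    ([ambient_ricci]).  As [T] is skew, [T^2] is self-adjoint, its eigenspaces
    are orthogonal, and they decompose [|X|^2], [|TX|^2] and the trace of
    [T^2] ([gM_norm_decomposition], [gM_TT], [sum_gM_TT]); also [g(TX,X) = 0].
    After this substitution the bound on the Ricci curvature exceeds the trace
    by [m |X|^2], and the bound on the scalar curvature, multiplied by
    [m (m+1)], exceeds the sum of the traces for [X = E_a] by [m^2 + m].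

    The differential geometry under this argument is that of vector fields
    along the immersion [i], differentiated with the pull-back connection
    [pullback_cov].  Three facts about it are needed.
    - It restricts to [D] on the fields [V \o i] ([pullback_comp]) and
      satisfies the Leibniz rule; therefore it can be computed at all points
      near [p] in one fixed chart of the ambient manifold ([pullback_expand]),
      although its definition uses another chart at each point.
    - Its torsion and curvature are the pull-backs of those of [D]
      ([pullback_torsion], [pullback_curvature]).  Both follow from
      X(Yf) - Y(Xf) = [X,Y]f for functions ([mderiv_lie_bracket]), that is,
      from the symmetry of second derivatives ([diff_diff_sym]).
    - The tangential part of a differentiable field along [i] is
      differentiable: near [p] it is the sum of the [g(W, E_a) E_a]
      ([near_tan_part]). *)

(** * Rules for differentials *)

Section Differentials.
Variable R : realType.

Lemma near_eq_is_diff (V W : normedModType R) (f g df : V -> W) (x : V) :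
  {near x, f =1 g} -> is_diff x f df -> is_diff x g df.
Proof.
move=> fg [/[dup] dfx /diff_locallyP[cdf fE] <-].
have gE : g \o shift x = cst (g x) + 'd f x +o_ 0 id.
  apply/eqaddoP => e e0; move/eqaddoP : fE => /(_ e e0) fE.
  have fgs : \forall y \near 0, f (y + x) = g (y + x).
    rewrite (near_shift x 0) sub0r; near=> y => /=.
    by rewrite subrK; near: y; exact: fg.
  near=> y.
  have -> : (g \o shift x - (cst (g x) + 'd f x)) y
     = (f \o shift x - (cst (f x) + 'd f x)) y.
    rewrite /= !fctE /= -(nbhs_singleton fg); congr (_ - _).
    by apply/esym; near: y; exact: fgs.
  by near: y; exact: fE.
have dg := diff_unique cdf gE.
apply: DiffDef; last exact: dg.
by apply/diff_locallyP; rewrite dg; split.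
Unshelve. all: by end_near. Qed.

Lemma near_eq_differentiable (V W : normedModType R) (f g : V -> W) (x : V) :
  {near x, f =1 g} -> differentiable f x -> differentiable g x.
Proof. by move=> fg /differentiableP/(near_eq_is_diff fg)[]. Qed.


Lemma is_diff_sumf (V W : normedModType R) (I : Type) (r : seq I)
    (f df : I -> V -> W) (x : V) :
  (forall i, is_diff x (f i) (df i)) ->
  is_diff x (fun y => \sum_(i <- r) f i y) (fun v => \sum_(i <- r) df i v).
Proof.
move=> fdf; elim: r => [|i r IHr].
  rewrite (_ : (fun y => _) = cst 0); last by apply/funext => y; rewrite big_nil.
  apply: is_diff_eq (is_diff_cst 0 x) _.
  by apply/funext => v; rewrite big_nil.
rewrite (_ : (fun y => _) = f i + (fun y => \sum_(i <- r) f i y)); last first.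
  by apply/funext => y; rewrite big_cons.
apply: is_diff_eq (is_diffD (fdf i) IHr) _.
by apply/funext => v; rewrite big_cons.
Qed.

Lemma is_diff_coord (V : normedModType R) m n (f df : V -> 'M[R]_(m, n))
    (x : V) i j :
  is_diff x f df -> is_diff x (fun y => f y i j) (fun v => df v i j).
Proof.
move=> fdf.
pose c (M : 'M[R]_(m, n)) : R := M i j.
have c_lin : linear c by move=> a M N; rewrite /c !mxE.
pose cM := GRing.isLinear.Build _ _ _ _ _ c_lin.
pose cL : {linear _ -> _} := HB.pack c cM.
have c_cont : continuous cL by exact: coord_continuous.
have cdiff : is_diff (f x) c c.
  apply: DiffDef; first exact: (@linear_differentiable _ _ _ cL _ c_cont).
  exact: (@diff_lin _ _ _ cL _ c_cont).
exact: (is_diff_comp fdf cdiff).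
Qed.

Lemma is_diff_scaleconst (V W : normedModType R) (f df : V -> R) (w : W)
    (x : V) :
  is_diff x f df -> is_diff x (fun y => f y *: w) (fun v => df v *: w).
Proof. by move=> fdf; apply: (is_diff_comp fdf (is_diff_scalel _ _)). Qed.

Lemma is_diff_row (V : normedModType R) n (f df : V -> 'rV[R]_n) (x : V) :
  (forall j, is_diff x (fun y => f y 0 j) (fun v => df v 0 j)) ->
  is_diff x f df.
Proof.
move=> fdf.
have := is_diff_sumf (index_enum 'I_n)
   (fun j => is_diff_scaleconst (delta_mx 0 j : 'rV[R]_n) (fdf j)).
rewrite (_ : (fun y => _) = f); last first.
  by apply/funext => y; rewrite -row_sum_delta.
by rewrite (_ : (fun y => _) = df) //; apply/funext => y; rewrite -row_sum_delta.
Qed.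

Lemma is_diff_mul (V : normedModType R) (f g df dg : V -> R) (x : V) :
  is_diff x f df -> is_diff x g dg ->
  is_diff x (fun y => f y * g y) (fun v => df v * g x + f x * dg v).
Proof.
move=> fdf gdg; apply: is_diff_eq (is_diffM fdf gdg) _.
by apply/funext => v; rewrite !fctE /= [RHS]addrC [df v * _]mulrC.
Qed.

Lemma is_diff_scale (V : normedModType R) n (f df : V -> R)
    (g dg : V -> 'rV[R]_n) (x : V) :
  is_diff x f df -> is_diff x g dg ->
  is_diff x (fun y => f y *: g y) (fun v => df v *: g x + f x *: dg v).
Proof.
move=> fdf gdg; apply: is_diff_row => j.
rewrite (_ : (fun y => _) = fun y => f y * g y 0 j); last first.
  by apply/funext => y; rewrite mxE.
apply: is_diff_eq (is_diff_mul fdf (is_diff_coord 0 j gdg)) _.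
by apply/funext => v; rewrite !mxE.
Qed.

End Differentials.

(** * Functions of class C^n on an open set *)

Section Cn.
Variables (R : realType) (d : nat).
Implicit Types (V : normedModType R) (U : set 'rV[R]_d).

(** On an open set, [smooth_at] amounts to [Cn n] for all [n] ([smooth_atP]);
    the recursion on [n] is what the inductive proofs for products and
    composites need. *)
Fixpoint Cn V (n : nat) U (f : 'rV[R]_d -> V) : Prop :=
  (forall x, U x -> differentiable f x) /\
  (if n is n'.+1 then forall j, Cn n' U (partial j f) else True).

Lemma Cn_differentiable V n U (f : 'rV[R]_d -> V) x :
  Cn n U f -> U x -> differentiable f x.
Proof. by case: n => [|n] [df _]; exact: df. Qed.

Lemma Cn_partial V n U (f : 'rV[R]_d -> V) j :
  Cn n.+1 U f -> Cn n U (partial j f).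
Proof. by case=> _; apply. Qed.

Lemma CnW V n U (f : 'rV[R]_d -> V) : Cn n.+1 U f -> Cn n U f.
Proof.
elim: n f => [|n IHn] f [df pf]; split=> // j.
by apply: IHn; apply: pf.
Qed.

Lemma open_near_eq (T : topologicalType) (U : set T) (W : Type) (f g : T -> W)
    x : open U -> {in U, f =1 g} -> U x -> {near x, f =1 g}.
Proof.
move=> Uo fg Ux; near=> y; apply: fg; rewrite inE.
by near: y; exact: open_nbhs_nbhs.
Unshelve. all: by end_near. Qed.

Lemma Cn_eq V n U (f g : 'rV[R]_d -> V) :
  open U -> {in U, f =1 g} -> Cn n U f -> Cn n U g.
Proof.
move=> Uo; elim: n f g => [|n IHn] f g fg [df pf]; (split=> //; first
    by move=> x Ux; exact: near_eq_differentiable (open_near_eq Uo fg Ux) (df _ Ux)).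
move=> j; apply: (IHn (partial j f)) => [x|]; last exact: pf.
  by rewrite inE => Ux; apply: near_eq_derive; exact: open_near_eq fg Ux.
Qed.

Lemma Cn_subset V n U U' (f : 'rV[R]_d -> V) :
  U' `<=` U -> Cn n U f -> Cn n U' f.
Proof.
move=> U'U; elim: n f => [|n IHn] f [df pf]; (split=> //; first by move=> x /U'U; exact: df).
by move=> j; exact: IHn (pf j).
Qed.

Lemma partial_is_diff V (f df : 'rV[R]_d -> V) x j :
  is_diff x f df -> partial j f x = df (delta_mx 0 j).
Proof. by case=> dfx <-; rewrite /partial deriveE. Qed.

Lemma diff_partialE V (f : 'rV[R]_d -> V) x v : differentiable f x ->
  'd f x v = \sum_j v 0 j *: partial j f x.
Proof.
move=> df; rewrite {1}(row_sum_delta v) linear_sum; apply: eq_bigr => j _.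
by rewrite linearZ (partial_is_diff j (differentiableP df)).
Qed.

Lemma Cn_cst V n U (w : V) : open U -> Cn n U (fun=> w).
Proof.
move=> Uo; elim: n w => [|n IHn] w; split=> // j.
 apply: Cn_eq (IHn 0) => // x _.
by rewrite (partial_is_diff j (is_diff_cst w x)).
Qed.

Lemma CnD V n U (f g : 'rV[R]_d -> V) : open U ->
  Cn n U f -> Cn n U g -> Cn n U (fun x => f x + g x).
Proof.
move=> Uo; elim: n f g => [|n IHn] f g [df pf] [dg pg]; (split=> //; first
    by move=> x Ux; exact: differentiableD (df _ Ux) (dg _ Ux)).
move=> j; apply: (@Cn_eq _ _ _ (fun x => partial j f x + partial j g x)) => // [x|].
    rewrite inE => Ux.
    have := is_diffD (differentiableP (df _ Ux)) (differentiableP (dg _ Ux)).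
    by move=> /(partial_is_diff j) -> /=; rewrite fctE /partial !deriveE; auto.
  exact: IHn (pf j) (pg j).
Qed.

Lemma Cn_sum V n U (I : Type) (r : seq I) (f : I -> 'rV[R]_d -> V) : open U ->
  (forall i, Cn n U (f i)) -> Cn n U (fun x => \sum_(i <- r) f i x).
Proof.
move=> Uo fC; elim: r => [|i r IHr].
  by apply: Cn_eq (Cn_cst n 0 Uo) => // x _; rewrite big_nil.
by apply: Cn_eq (CnD Uo (fC i) IHr) => // x _; rewrite big_cons.
Qed.

Lemma CnM n U (f g : 'rV[R]_d -> R) : open U ->
  Cn n U f -> Cn n U g -> Cn n U (fun x => f x * g x).
Proof.
move=> Uo; elim: n f g => [|n IHn] f g fC gC.
  split=> // x Ux.
  by have [] := is_diff_mul (differentiableP (Cn_differentiable fC Ux))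
                   (differentiableP (Cn_differentiable gC Ux)).
split=> [x Ux|j].
  by have [] := is_diff_mul (differentiableP (Cn_differentiable fC Ux))
                   (differentiableP (Cn_differentiable gC Ux)).
apply: (@Cn_eq _ _ _ (fun x => partial j f x * g x + f x * partial j g x)) => // [x|].
  rewrite inE => Ux.
  have dfx := Cn_differentiable fC Ux; have dgx := Cn_differentiable gC Ux.
  have := is_diff_mul (differentiableP dfx) (differentiableP dgx).
  by move=> /(partial_is_diff j) -> /=; rewrite /partial !deriveE; auto.
by apply: CnD => //; apply: IHn; do ?[exact: Cn_partial | exact: CnW].
Qed.

Lemma Cn_scaleconst V n U (f : 'rV[R]_d -> R) (w : V) : open U ->
  Cn n U f -> Cn n U (fun x => f x *: w).
Proof.
move=> Uo; elim: n f => [|n IHn] f fC.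
  split=> // x Ux.
  by have [] := is_diff_scaleconst w (differentiableP (Cn_differentiable fC Ux)).
split=> [x Ux|j].
  by have [] := is_diff_scaleconst w (differentiableP (Cn_differentiable fC Ux)).
apply: (@Cn_eq _ _ _ (fun x => partial j f x *: w)) => // [x|].
  rewrite inE => Ux; have dfx := Cn_differentiable fC Ux.
  have := is_diff_scaleconst w (differentiableP dfx).
  by move=> /(partial_is_diff j) -> /=; rewrite /partial !deriveE; auto.
by apply: IHn; exact: Cn_partial.
Qed.

Lemma Cn_coord n U m1 m2 (f : 'rV[R]_d -> 'M[R]_(m1, m2)) i j : open U ->
  Cn n U f -> Cn n U (fun x => f x i j).
Proof.
move=> Uo; elim: n f => [|n IHn] f fC.
  split=> // x Ux.
  by have [] := is_diff_coord i j (differentiableP (Cn_differentiable fC Ux)).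
split=> [x Ux|k].
  by have [] := is_diff_coord i j (differentiableP (Cn_differentiable fC Ux)).
apply: (@Cn_eq _ _ _ (fun x => partial k f x i j)) => // [x|].
  rewrite inE => Ux; have dfx := Cn_differentiable fC Ux.
  have := is_diff_coord i j (differentiableP dfx).
  by move=> /(partial_is_diff k) -> /=; rewrite /partial !deriveE; auto.
by apply: IHn; exact: Cn_partial.
Qed.

Lemma Cn_row n U m (f : 'rV[R]_d -> 'rV[R]_m) : open U ->
  (forall j, Cn n U (fun x => f x 0 j)) -> Cn n U f.
Proof.
move=> Uo fC.
have := Cn_sum (index_enum 'I_m) Uo
   (fun j => Cn_scaleconst (delta_mx 0 j : 'rV[R]_m) Uo (fC j)).
by apply: Cn_eq => // x _; rewrite -row_sum_delta.
Qed.

End Cn.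

(** Induction through the chain rule
    [partial j (f \o g) = \sum_k (partial k f \o g) * partial j g_k], where
    the composites on the right have one derivative less to go. *)
Lemma Cn_comp (R : realType) (d e : nat) n (U : set 'rV[R]_d) (V : set 'rV[R]_e)
    (f : 'rV[R]_e -> R) (g : 'rV[R]_d -> 'rV[R]_e) :
  open U -> open V -> (forall x, U x -> V (g x)) ->
  Cn n V f -> Cn n U g -> Cn n U (f \o g).
Proof.
move=> Uo Vo UV; elim: n f => [|n IHn] f fC gC.
  by split=> // x Ux; apply: differentiable_comp;
    [exact: Cn_differentiable gC Ux|exact: Cn_differentiable fC (UV _ Ux)].
split=> [x Ux|j].
  by apply: differentiable_comp;
    [exact: Cn_differentiable gC Ux|exact: Cn_differentiable fC (UV _ Ux)].
apply: (@Cn_eq _ _ _ _ _ (fun x => \sum_k partial j g x 0 k * (partial k f \o g) x)) => // [x|].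
  rewrite inE => Ux; have dfx := Cn_differentiable fC (UV _ Ux).
  have dgx := Cn_differentiable gC Ux.
  have /(partial_is_diff j) -> := is_diff_comp (differentiableP dgx) (differentiableP dfx).
  by rewrite /= (diff_partialE _ dfx) (partial_is_diff j (differentiableP dgx)).
apply: Cn_sum => // k; apply: CnM => //.
  by apply: Cn_coord => //; exact: Cn_partial.
by apply: IHn; [exact: Cn_partial|exact: CnW].
Qed.

Lemma smooth_atP (R : realType) (d : nat) (V : normedModType R)
    (f : 'rV[R]_d -> V) x :
  smooth_at f x <-> exists U, [/\ open U, U x & forall n, Cn n U f].
Proof.
have CnP U : (forall n, Cn n U f) <->
    (forall y, U y -> forall s : seq 'I_d, differentiable (foldr (@partial _ _ _) f s) y).
  split=> [fC y Uy s|fC n].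
    suff : Cn 0 U (foldr (@partial _ _ _) f s) by case=> /(_ y Uy).
    elim/last_ind: s f fC => [|s j IHs] h hC; first exact: hC.
    by rewrite foldr_rcons; apply: IHs => n; apply: Cn_partial (hC n.+1).
  elim: n f fC => [|n IHn] h hC; (split=> //; first by move=> y Uy; exact: (hC y Uy [::])).
  by move=> j; apply: IHn => y Uy s; have := hC y Uy (rcons s j); rewrite foldr_rcons.
split=> [|[U [Uo Ux /CnP fC]]].
  move=> fs; have : nbhs x [set y | forall s : seq 'I_d,
    differentiable (foldr (@partial _ _ _) f s) y] by exact: fs.
  rewrite nbhsE => -[U [Uo Ux] UC].
  by exists U; split=> //; apply/CnP => y /UC.
rewrite /smooth_at; near=> y; apply: fC; near: y; exact: open_nbhs_nbhs.
Unshelve. all: by end_near. Qed.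

(** * Symmetry of second derivatives *)

Section Young.
Variables (R : realType) (V : normedModType R).
Implicit Types (f : V -> R) (x u v : V).

Lemma diffZr f x u (h : R) : 'd f x (h *: u) = h * 'd f x u.
Proof. exact: linearZ. Qed.

Lemma diffDr f x u v : 'd f x (u + v) = 'd f x u + 'd f x v.
Proof. exact: linearD. Qed.

Let second_difference f x u v (t : R) :=
  f (x + t *: u + t *: v) - f (x + t *: u) - f (x + t *: v) + f x.

(** By the mean value theorem along [u], the second difference is [t] times
    the increment of ['d f _ u] between two points of the form [x + O(t)] that
    differ by [t *: v]; its first-order expansion at [x] gives the claim. *)
Lemma second_difference_approx f x u v (e : R) :
  (\forall y \near x, differentiable f y) ->
  differentiable (fun y => 'd f y u) x -> 0 < e ->
  exists2 r, 0 < r & forall t, 0 < t -> t < r ->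
    `|second_difference f x u v t - t ^+ 2 * 'd (fun y => 'd f y u) x v|
      <= e * t ^+ 2.
Proof.
move=> df ddf e0; set A := 'd (fun y => 'd f y u) x.
(* [t * C] bounds the norms of all the increments at hand, and the factor 2
   is for the two remainders of the expansion. *)
set C := 2 * (`|u| + `|v|) + 1.
have C0 : 0 < C by rewrite ltr_wpDl// mulr_ge0// addr_ge0.
pose e' := e / C; have e'0 : 0 < e' by rewrite divr_gt0.
have /eqaddoP/(_ e' e'0) := diff_locally ddf.
move=> /nbhs_ballP[r1 /= r10 r1P].
move: df => /nbhs_ballP[r2 /= r20 r2P].
exists (Num.min r1 r2 / C) => [|t t0 tr]; first by rewrite divr_gt0// lt_min r10.
have tC : t * C < Num.min r1 r2 by rewrite -ltr_pdivlMr.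
have bound (c d : R) : 0 <= c -> c <= t -> 0 <= d -> d <= t ->
    `|c *: u + d *: v| < Num.min r1 r2.
  move=> c0 ct d0 dt; apply: le_lt_trans tC.
  rewrite (le_trans (ler_normD _ _))// !normrZ !ger0_norm//.
  have cu : c * `|u| <= t * `|u| by rewrite ler_wpM2r.
  have dv : d * `|v| <= t * `|v| by rewrite ler_wpM2r.
  have tu : 0 <= t * `|u| by rewrite mulr_ge0// ltW.
  have tv : 0 <= t * `|v| by rewrite mulr_ge0// ltW.
  by rewrite /C; lra.
have dfc (c d : R) : 0 <= c -> c <= t -> 0 <= d -> d <= t ->
    differentiable f (x + (c *: u + d *: v)).
  move=> c0 ct d0 dt; apply: r2P; rewrite -ball_normE /= opprD addrA subrr.
  rewrite add0r normrN.
  by have := bound c d c0 ct d0 dt; rewrite lt_min => /andP[].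
pose dphi (s : R) := 'd f (x + (s *: u + t *: v)) u
                     - 'd f (x + (s *: u + 0 *: v)) u.
pose phi (s : R) := f (x + (s *: u + t *: v)) - f (x + (s *: u + 0 *: v)).
have dline (s d : R) : 0 <= s -> s <= t -> 0 <= d -> d <= t ->
   is_diff s (fun s => f (x + (s *: u + d *: v)))
     (fun h => 'd f (x + (s *: u + d *: v)) (h *: u)).
  move=> s0 st d0 dt.
  have aff : is_diff s (fun s : R => x + (s *: u + d *: v)) ( *:%R^~ u).
    rewrite (_ : (fun s => _) = cst (x + d *: v) + ( *:%R^~ u)); last first.
      by apply/funext => z; rewrite fctE /= -addrA [d *: v + _]addrC.
    apply: is_diff_eq (is_diffD (is_diff_cst _ _) (is_diff_scalel _ _)) _.
    by apply/funext => h; rewrite fctE /= add0r.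
  exact: (is_diff_comp aff (differentiableP (dfc _ _ s0 st d0 dt))).
have phiD (s : R) : 0 <= s -> s <= t -> is_diff s phi (fun h => h * dphi s).
  move=> s0 st.
  apply: is_diff_eq (is_diffB (dline s t s0 st (ltW t0) (lexx _))
                              (dline s 0 s0 st (lexx _) (ltW t0))) _.
  apply/funext => h; rewrite /dphi mulrBr -!diffZr; exact: erefl.
have [c||c cI] := @MVT R phi dphi 0 t t0.
- rewrite in_itv /= => /andP[/ltW c0 /ltW ct]; have [dc pc] := phiD c c0 ct.
  apply: DeriveDef; first exact: diff_derivable.
  by rewrite deriveE// pc mul1r.
- apply: continuous_in_subspaceT => z; rewrite inE /= in_itv /= => /andP[z0 zt].
  by apply: differentiable_continuous; have [] := phiD z z0 zt.
move: cI; rewrite in_itv /= subr0 => /andP[/ltW c0 /ltW ct] E.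
have -> : second_difference f x u v t = phi t - phi 0.
  rewrite /phi /second_difference !scale0r !addr0 add0r !addrA.
  by rewrite opprB addrA addrAC.
rewrite {}E /dphi.
pose rm (h : V) := 'd f (x + h) u - ('d f x u + A h).
have rmP (d : R) : 0 <= d -> d <= t -> `|rm (c *: u + d *: v)| <= e' * (t * (`|u| + `|v|)).
  move=> d0 dt; have := r1P (c *: u + d *: v); rewrite -ball_normE /= sub0r normrN.
  move=> /(_ _)/=; rewrite !fctE /= => r1P'.
  rewrite /rm [x + _]addrC; apply: le_trans (r1P' _) _.
    by have := bound c d c0 ct d0 dt; rewrite lt_min => /andP[].
  rewrite ler_wpM2l ?(ltW e'0)// (le_trans (ler_normD _ _))// !normrZ.
  by rewrite !ger0_norm// mulrDr lerD// ler_wpM2r.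
have AE b : A (c *: u + b *: v) = c * A u + b * A v by rewrite /A diffDr !diffZr.
have -> : ('d f (x + (c *: u + t *: v)) u - 'd f (x + (c *: u + 0 *: v)) u)
    * t - t ^+ 2 * A v
    = t * (rm (c *: u + t *: v) - rm (c *: u + 0 *: v)).
  by rewrite /rm !AE; clearbody A; ring.
rewrite normrM (gtr0_norm t0).
have e't : e' * (t * (`|u| + `|v|)) *+ 2 <= e * t.
  rewrite -mulr_natl (_ : _ * _ = e' * t * (2 * (`|u| + `|v|))); last by ring.
  rewrite (_ : e * t = e' * t * C); last by rewrite /e'; field; rewrite gt_eqF.
  by apply: ler_wpM2l; [rewrite mulr_ge0 ?(ltW e'0) ?(ltW t0)|rewrite /C lerDl].
rewrite [leRHS](_ : _ = t * (e * t)); last by ring.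
rewrite ler_wpM2l ?(ltW t0)// (le_trans (ler_normB _ _))//.
apply: le_trans e't; rewrite mulr2n lerD// rmP// ?lexx// ltW//.
Qed.

(** Young's theorem: both mixed derivatives are the limit of
    [second_difference f x u v t / t ^+ 2], which is symmetric in [u], [v]. *)
Lemma diff_diff_sym f x u v :
  (\forall y \near x, differentiable f y) ->
  differentiable (fun y => 'd f y u) x ->
  differentiable (fun y => 'd f y v) x ->
  'd (fun y => 'd f y u) x v = 'd (fun y => 'd f y v) x u.
Proof.
move=> df du dv; apply/subr0_eq/eqP; rewrite -normr_eq0 eq_le normr_ge0 andbT.
apply/ler_addgt0Pl => e e0; rewrite addr0.
have e20 : 0 < e / 2 by rewrite divr_gt0.
have [r1 r10 r1P] := second_difference_approx v df du e20.
have [r2 r20 r2P] := second_difference_approx u df dv e20.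
pose t := Num.min r1 r2 / 2.
have m0 : 0 < Num.min r1 r2 by rewrite lt_min r10.
have t0 : 0 < t by rewrite divr_gt0.
have tm : t < Num.min r1 r2 by rewrite /t ltr_pdivrMr// ltr_pMr// ltr1n.
move: tm; rewrite lt_min => /andP[t1 t2].
have := r1P t t0 t1; have := r2P t t0 t2.
have -> : second_difference f x v u t = second_difference f x u v t.
  by rewrite /second_difference [x + _ + _]addrAC; ring.
set A := 'd _ x v; set B := 'd _ x u; set D := second_difference _ _ _ _ _.
move=> B2 A2; rewrite -(ler_pM2l (exprn_gt0 2 t0)) -[X in X * `|_|]gtr0_norm ?exprn_gt0//.
rewrite -normrM.
have -> : t ^+ 2 * (A - B) = (D - t ^+ 2 * B) - (D - t ^+ 2 * A) by ring.
rewrite (le_trans (ler_normB _ _))// (le_trans (lerD B2 A2))//.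
by rewrite -mulrDl -splitr mulrC.
Qed.

End Young.

(** * Smooth functions near a point *)

Section SmoothAt.
Variables (R : realType) (d : nat).
Implicit Types (V : normedModType R).

Lemma smooth_at_differentiable V (f : 'rV[R]_d -> V) x :
  smooth_at f x -> \forall y \near x, differentiable f y.
Proof. by apply: filterS => y /(_ [::]). Qed.

Lemma smooth_at_differentiable1 V (f : 'rV[R]_d -> V) x :
  smooth_at f x -> differentiable f x.
Proof. by move/smooth_at_differentiable/nbhs_singleton. Qed.

Lemma smooth_at_partial V (f : 'rV[R]_d -> V) x j :
  smooth_at f x -> smooth_at (partial j f) x.
Proof.
move=> /smooth_atP[U [Uo Ux UC]]; apply/smooth_atP; exists U; split=> // n.
exact: Cn_partial (UC n.+1).
Qed.

Lemma near_eq_smooth_at V (f g : 'rV[R]_d -> V) x :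
  {near x, f =1 g} -> smooth_at f x -> smooth_at g x.
Proof.
move=> fg /smooth_atP[U [Uo Ux UC]]; apply/smooth_atP.
move: (fg); rewrite {1}/prop_near1 nbhsE => -[W [Wo Wx] WP].
exists (U `&` W); split=> [||n]; [exact: openI|by []|].
apply: (@Cn_eq _ _ _ _ _ f); first exact: openI.
  by move=> y; rewrite inE => -[_ /WP].
by apply: Cn_subset (UC n) => y [].
Qed.

Lemma smooth_at_comp (e : nat) m (f : 'rV[R]_e -> 'rV[R]_m)
    (g : 'rV[R]_d -> 'rV[R]_e) x :
  smooth_at g x -> smooth_at f (g x) -> smooth_at (f \o g) x.
Proof.
move=> /smooth_atP[U [Uo Ux UC]] /smooth_atP[V [Vo Vx VC]]; apply/smooth_atP.
have gc : {for x, continuous g}.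
  by apply: differentiable_continuous; exact: Cn_differentiable (UC 0) Ux.
have : nbhs x (U `&` g @^-1` V).
  apply: filterI; first exact: open_nbhs_nbhs.
  by apply: gc; exact: open_nbhs_nbhs.
rewrite nbhsE => -[W [Wo Wx] WP]; exists W; split=> // n.
apply: Cn_row => // j.
apply: (@Cn_comp _ _ _ _ W V (fun y => f y 0 j)) => //.
- by move=> y /WP[].
- exact: Cn_coord.
- by apply: Cn_subset (UC n) => y /WP[].
Qed.

Lemma smooth_at_cst V (w : V) (x : 'rV[R]_d) : smooth_at (fun=> w) x.
Proof.
by apply/smooth_atP; exists setT; split=> //; [exact: openT|move=> n; exact/Cn_cst/openT].
Qed.

Lemma smooth_at_scaleconst V (f : 'rV[R]_d -> R) (w : V) x :
  smooth_at f x -> smooth_at (fun y => f y *: w) x.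
Proof.
move=> /smooth_atP[U [Uo Ux UC]]; apply/smooth_atP; exists U; split=> // n.
exact: Cn_scaleconst.
Qed.

Lemma smooth_at_coord m1 m2 (f : 'rV[R]_d -> 'M[R]_(m1, m2)) i j x :
  smooth_at f x -> smooth_at (fun y => f y i j) x.
Proof.
move=> /smooth_atP[U [Uo Ux UC]]; apply/smooth_atP; exists U; split=> // n.
exact: Cn_coord.
Qed.

Lemma smooth_atD V (f g : 'rV[R]_d -> V) x :
  smooth_at f x -> smooth_at g x -> smooth_at (fun y => f y + g y) x.
Proof.
move=> /smooth_atP[U [Uo Ux UC]] /smooth_atP[W [Wo Wx WC]]; apply/smooth_atP.
exists (U `&` W); split=> [||n]; [exact: openI|by []|].
apply: CnD; first exact: openI.
  by apply: Cn_subset (UC n) => y [].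
by apply: Cn_subset (WC n) => y [].
Qed.

Lemma smooth_atM (f g : 'rV[R]_d -> R) x :
  smooth_at f x -> smooth_at g x -> smooth_at (fun y => f y * g y) x.
Proof.
move=> /smooth_atP[U [Uo Ux UC]] /smooth_atP[W [Wo Wx WC]]; apply/smooth_atP.
exists (U `&` W); split=> [||n]; [exact: openI|by []|].
apply: CnM; first exact: openI.
  by apply: Cn_subset (UC n) => y [].
by apply: Cn_subset (WC n) => y [].
Qed.

Lemma smooth_at_sum V (I : Type) (r : seq I) (f : I -> 'rV[R]_d -> V) x :
  (forall i, smooth_at (f i) x) -> smooth_at (fun y => \sum_(i <- r) f i y) x.
Proof.
move=> fs; elim: r => [|i r IHr].
  rewrite (_ : (fun y => _) = fun=> 0); first exact: smooth_at_cst.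
  by apply/funext => y; rewrite big_nil.
rewrite (_ : (fun y => _) = fun y => f i y + \sum_(i <- r) f i y).
  exact: smooth_atD.
by apply/funext => y; rewrite big_cons.
Qed.

Lemma smooth_at_row m (f : 'rV[R]_d -> 'rV[R]_m) x :
  (forall j, smooth_at (fun y => f y 0 j) x) -> smooth_at f x.
Proof.
move=> fs; rewrite (_ : f = fun y => \sum_j f y 0 j *: delta_mx 0 j).
  by apply: smooth_at_sum => j; exact: smooth_at_scaleconst.
by apply/funext => y; rewrite -row_sum_delta.
Qed.

Lemma smooth_at_scale m (f : 'rV[R]_d -> R) (g : 'rV[R]_d -> 'rV[R]_m) x :
  smooth_at f x -> smooth_at g x -> smooth_at (fun y => f y *: g y) x.
Proof.
move=> fs gs; apply: smooth_at_row => j.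
rewrite (_ : (fun y => _) = fun y => f y * g y 0 j).
  exact: smooth_atM (smooth_at_coord _ _ _).
by apply/funext => y; rewrite mxE.
Qed.

End SmoothAt.

(** * Charts, components of vectors and derivatives on a manifold *)

Section Charts.
Variables (R : realType) (d : nat) (N : manifold R d).
Implicit Types (c : chart N) (p q : N) (V : normedModType R).

Lemma near_cmap c p (Q : 'rV[R]_d -> Prop) : cdom c p ->
  (\forall x \near cmap c p, Q x) -> \forall q \near p, Q (cmap c q).
Proof. by move=> cp; exact: (cmap_continuous cp). Qed.

Lemma near_cinv c p (P : N -> Prop) : cdom c p ->
  (\forall q \near p, P q) -> \forall x \near cmap c p, P (cinv c x).
Proof.
move=> cp Pp; apply: (cinv_continuous cp).
by rewrite (cmapK cp).
Qed.

Lemma near_cdom c p : cdom c p -> \forall q \near p, cdom c q.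
Proof. by move=> cp; apply: open_nbhs_nbhs; split=> //; exact: cdom_open. Qed.

Lemma near_cinvK c p : cdom c p ->
  \forall x \near cmap c p, cmap c (cinv c x) = x.
Proof.
move=> cp; have : nbhs (cmap c p) (cmap c @` cdom c).
  by apply: open_nbhs_nbhs; split; [exact: cimage_open|exists p].
by apply: filterS => x [q cq <-]; rewrite (cmapK cq).
Qed.

Lemma near_transition V c c' p (F : N -> V) : cdom c p -> cdom c' p ->
  {near cmap c' p, (F \o cinv c) \o (cmap c \o cinv c') =1 F \o cinv c'}.
Proof.
move=> cp c'p; have := near_cinv c'p (near_cdom cp).
by apply: filterS => x cx /=; rewrite (cmapK cx).
Qed.

Lemma is_diff_transition c c' p : cdom c p -> cdom c' p ->
  is_diff (cmap c p) (cmap c' \o cinv c)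
    (fun v => v *m transition_jacobian c c' p).
Proof.
move=> cp c'p; apply: DiffDef.
  exact: smooth_at_differentiable1 (transition_smooth cp c'p).
by apply/funext => v; rewrite /transition_jacobian mul_rV_lin1.
Qed.

(** Change of chart for derivatives; all the compatibilities between charts
    below come from this lemma and from the uniqueness of differentials. *)
Lemma is_diff_chart V c c' p (F : N -> V) dF : cdom c p -> cdom c' p ->
  is_diff (cmap c p) (F \o cinv c) dF ->
  is_diff (cmap c' p) (F \o cinv c')
    (fun v => dF (v *m transition_jacobian c' c p)).
Proof.
move=> cp c'p FdF; apply: near_eq_is_diff (near_transition F cp c'p) _.
apply: is_diff_comp (is_diff_transition c'p cp) _.
by rewrite /= (cmapK c'p).
Qed.

Lemma is_diff_fun_uniq (V W : normedModType R) (f : V -> W) (df df' : V -> W) (x : V) :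
  is_diff x f df -> is_diff x f df' -> df = df'.
Proof. by case=> _ <- [_ <-]. Qed.

Lemma row_mulmx_inj m (A B : 'M[R]_(d, m)) :
  (forall v : 'rV[R]_d, v *m A = v *m B) -> A = B.
Proof.
by move=> AB; apply/row_matrixP => j; rewrite !rowE.
Qed.

Lemma transition_jacobianK c c' c'' p : cdom c p -> cdom c' p -> cdom c'' p ->
  transition_jacobian c c' p *m transition_jacobian c' c'' p
  = transition_jacobian c c'' p.
Proof.
move=> cp c'p c''p; apply: row_mulmx_inj => v.
have := is_diff_chart c'p cp (is_diff_transition c'p c''p).
move=> /(is_diff_fun_uniq (is_diff_transition cp c''p)) /(congr1 (@^~ v)) /= ->.
by rewrite mulmxA.
Qed.

Lemma transition_jacobian1 c p : cdom c p -> transition_jacobian c c p = 1%:M.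
Proof.
move=> cp; apply: row_mulmx_inj => v; rewrite mulmx1.
have : is_diff (cmap c p) (cmap c \o cinv c) id.
  apply: near_eq_is_diff (is_diff_id _).
  by apply: filterS (near_cinvK cp) => x /= ->.
by move=> /(is_diff_fun_uniq (is_diff_transition cp cp)) /(congr1 (@^~ v)).
Qed.

Lemma tcoord_chart_at p v : tcoord (chart_at p) p v = v.
Proof. by rewrite /tcoord transition_jacobian1 ?mulmx1//; exact: cdom_chart_at. Qed.

Lemma tcoordK c c' p v : cdom c p -> cdom c' p ->
  tcoord c p v *m transition_jacobian c c' p = tcoord c' p v.
Proof.
move=> cp c'p; rewrite /tcoord -mulmxA transition_jacobianK//.
exact: cdom_chart_at.
Qed.

Lemma tcoord_coord_field c c' p j : cdom c p -> cdom c' p ->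
  tcoord c' p (coord_field c j p) = delta_mx 0 j *m transition_jacobian c c' p.
Proof.
move=> cp c'p; rewrite /tcoord /coord_field -mulmxA transition_jacobianK//.
exact: cdom_chart_at.
Qed.

Lemma coord_field_chart_at p j : coord_field (chart_at p) j p = delta_mx 0 j.
Proof.
by rewrite /coord_field transition_jacobian1 ?mulmx1//; exact: cdom_chart_at.
Qed.

Lemma tcoord_expand c p v : cdom c p ->
  v = \sum_j (tcoord c p v) 0 j *: coord_field c j p.
Proof.
move=> cp; rewrite -[LHS](tcoord_chart_at p).
rewrite -(tcoordK _ cp (cdom_chart_at p)) {1}(row_sum_delta (tcoord c p v)).
by rewrite mulmx_suml; apply: eq_bigr => j _; rewrite -scalemxAl.
Qed.

Lemma tcoordD c p v w : tcoord c p (v + w) = tcoord c p v + tcoord c p w.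
Proof. exact: mulmxDl. Qed.

Lemma tcoordZ c p a v : tcoord c p (a *: v) = a *: tcoord c p v.
Proof. by rewrite /tcoord -scalemxAl. Qed.

Definition is_mdiff V (F : N -> V) p (dF : 'rV[R]_d -> V) :=
  is_diff (cmap (chart_at p) p) (F \o cinv (chart_at p)) dF.

Lemma mderiv_is_mdiff V (F : N -> V) p dF : is_mdiff F p dF ->
  mderiv F p = dF.
Proof. by case. Qed.

(** Differentiability, phrased as an instance of [is_mdiff] so that it can be
    fed to the product rules for [is_mdiff]. *)
Definition mdiff V (F : N -> V) p := is_mdiff F p (mderiv F p).

Lemma is_mdiff_mdiff V (F : N -> V) p dF : is_mdiff F p dF -> mdiff F p.
Proof. by move=> FdF; rewrite /mdiff (mderiv_is_mdiff FdF). Qed.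

Lemma mdiff_differentiable V (F : N -> V) p :
  differentiable (F \o cinv (chart_at p)) (cmap (chart_at p) p) -> mdiff F p.
Proof. by move/differentiableP. Qed.

Lemma is_mdiff_chart V c p (F : N -> V) dF : cdom c p ->
  is_diff (cmap c p) (F \o cinv c) dF ->
  is_mdiff F p (fun v => dF (tcoord c p v)).
Proof. by move=> cp /(is_diff_chart cp (cdom_chart_at p)). Qed.

Lemma near_eq_is_mdiff V (F G : N -> V) p dF : {near p, F =1 G} ->
  is_mdiff F p dF -> is_mdiff G p dF.
Proof.
by move=> FG; apply: near_eq_is_diff; apply: near_cinv (cdom_chart_at p) FG.
Qed.

Lemma near_eq_mdiff V (F G : N -> V) p : {near p, F =1 G} ->
  mdiff F p -> mdiff G p.
Proof. by move=> FG /(near_eq_is_mdiff FG)/is_mdiff_mdiff. Qed.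

Lemma near_eq_mderiv V (F G : N -> V) p : {near p, F =1 G} -> mdiff F p ->
  mderiv G p = mderiv F p.
Proof. by move=> FG /(near_eq_is_mdiff FG)/mderiv_is_mdiff. Qed.

Lemma msmooth_mdiff V (F : N -> V) p : msmooth_at F p -> mdiff F p.
Proof. by move=> /smooth_at_differentiable1/mdiff_differentiable. Qed.

Lemma near_eq_msmooth V (F G : N -> V) p : {near p, F =1 G} ->
  msmooth_at F p -> msmooth_at G p.
Proof.
by move=> FG; apply: near_eq_smooth_at; apply: near_cinv (cdom_chart_at p) FG.
Qed.

Lemma near_eq_vsmooth (X Y : N -> 'rV[R]_d) p : {near p, X =1 Y} ->
  vsmooth_at X p -> vsmooth_at Y p.
Proof. by move=> XY; apply: near_eq_msmooth; apply: filterS XY => q ->. Qed.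

(** Smoothness at [p] is tested in [chart_at p], where the field is a row of
    the jacobian of a transition map composed with the inverse transition. *)
Lemma coord_field_smooth c p j : cdom c p -> vsmooth_at (coord_field c j) p.
Proof.
move=> cp; have c'p := cdom_chart_at p; set c' := chart_at p.
have S : smooth_at (partial j (cmap c' \o cinv c) \o (cmap c \o cinv c'))
    (cmap c' p).
  apply: smooth_at_comp (transition_smooth c'p cp) _.
  rewrite /= (cmapK c'p).
  exact: smooth_at_partial (transition_smooth cp c'p).
rewrite /vsmooth_at /msmooth_at -/c'; apply: near_eq_smooth_at S.
near=> x.
have cx : cdom c (cinv c' x) by near: x; exact: near_cinv (near_cdom cp).
have c'x : cdom c' (cinv c' x) by near: x; exact: near_cinv (near_cdom c'p).
rewrite /= tcoord_coord_field//.
by rewrite (partial_is_diff j (is_diff_transition cx c'x)).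
Unshelve. all: by end_near. Qed.

End Charts.

(** * Local form of a connection *)

Section Connection.
Variables (R : realType) (d : nat) (N : manifold R d).
Implicit Types (c : chart N) (p q : N) (X Y W : N -> 'rV[R]_d).

Lemma vsmooth0 p : vsmooth_at (fun=> 0 : 'rV[R]_d) p.
Proof.
rewrite /vsmooth_at (_ : (fun q => _) = fun=> 0); first exact: smooth_at_cst.
by apply/funext => q; rewrite /tcoord mul0mx.
Qed.

Lemma vsmoothD X Y p : vsmooth_at X p -> vsmooth_at Y p ->
  vsmooth_at (fun q => X q + Y q) p.
Proof.
move=> Xs Ys; rewrite /vsmooth_at (_ : (fun q => _) =
  fun q => tcoord (chart_at p) q (X q) + tcoord (chart_at p) q (Y q)).
  exact: smooth_atD.
by apply/funext => q; rewrite tcoordD.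
Qed.

Lemma vsmoothZ (f : N -> R) Y p : msmooth_at f p -> vsmooth_at Y p ->
  vsmooth_at (fun q => f q *: Y q) p.
Proof.
move=> fs Ys; rewrite /vsmooth_at (_ : (fun q => _) =
  fun q => f q *: tcoord (chart_at p) q (Y q)).
  exact: smooth_at_scale.
by apply/funext => q; rewrite tcoordZ.
Qed.

Lemma vsmooth_sum (I : Type) (r : seq I) (Y : I -> N -> 'rV[R]_d) p :
  (forall i, vsmooth_at (Y i) p) ->
  vsmooth_at (fun q => \sum_(i <- r) Y i q) p.
Proof.
move=> Ys; elim: r => [|i r IHr].
  by rewrite (_ : (fun q => _) = fun=> 0);
    [exact: vsmooth0|apply/funext => q; rewrite big_nil].
rewrite (_ : (fun q => _) = fun q => Y i q + \sum_(i <- r) Y i q).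
  exact: vsmoothD.
by apply/funext => q; rewrite big_cons.
Qed.

Lemma is_mdiff_cst (V : normedModType R) (w : V) p :
  is_mdiff (fun _ : N => w) p (fun=> 0).
Proof. exact: is_diff_cst. Qed.

Variable D : cov_op N.
Hypothesis Dc : connection D.

(** Multiply by the indicator of the set where [W] and [W'] agree: it is
    constant near [p], so the Leibniz rule leaves the derivatives unchanged. *)
Lemma conn_local W W' p v : {near p, W =1 W'} -> vsmooth_at W p ->
  D W p v = D W' p v.
Proof.
move=> WW' Ws; have W's := near_eq_vsmooth WW' Ws.
pose f q : R := (`[< W q = W' q >])%:R.
have f1 : {near p, (fun=> 1) =1 f}.
  by apply: filterS WW' => q qE; rewrite /f (asboolT qE).
have fs : msmooth_at f p by apply: near_eq_msmooth f1 _; exact: smooth_at_cst.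
have df : mderiv f p = fun=> 0.
  exact/mderiv_is_mdiff/(near_eq_is_mdiff f1)/is_mdiff_cst.
have fp : f p = 1 by rewrite -(nbhs_singleton f1).
have := conn_leibniz Dc v fs Ws; have := conn_leibniz Dc v fs W's.
rewrite df fp !scale0r !scale1r !add0r => <- <-; congr (D _ p v).
apply/funext => q; rewrite /f.
by case: asboolP => [->//|_]; rewrite !scale0r.
Qed.

Lemma conn0 p v : D (fun=> 0) p v = 0.
Proof.
have := conn_leibniz Dc v (smooth_at_cst (0 : R) _ : msmooth_at (fun=> 0) p)
  (vsmooth0 p).
rewrite (mderiv_is_mdiff (is_mdiff_cst _ _)) !scale0r addr0 => H.
by rewrite -[RHS]H; congr (D _ p v); apply/funext => q; rewrite scaler0.
Qed.

Lemma conn_sum (I : Type) (r : seq I) (Y : I -> N -> 'rV[R]_d) p v :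
  (forall i, vsmooth_at (Y i) p) ->
  D (fun q => \sum_(i <- r) Y i q) p v = \sum_(i <- r) D (Y i) p v.
Proof.
move=> Ys; elim: r => [|i r IHr].
  rewrite big_nil -[RHS](conn0 p v); congr (D _ p v).
  by apply/funext => q; rewrite big_nil.
rewrite big_cons -IHr -(conn_add Dc)//; last exact: vsmooth_sum.
by congr (D _ p v); apply/funext => q; rewrite big_cons.
Qed.

Lemma connD Y p v w : vsmooth_at Y p -> D Y p (v + w) = D Y p v + D Y p w.
Proof. by move=> Ys; have := conn_linear Dc 1 v w Ys; rewrite !scale1r. Qed.

Lemma conn_dir0 Y p : vsmooth_at Y p -> D Y p 0 = 0.
Proof.
move=> Ys; apply: (addrI (D Y p 0)).
by rewrite -connD// !addr0.
Qed.

Lemma conn_dir_sum (I : Type) (r : seq I) (a : I -> R) (w : I -> 'rV[R]_d) Y p :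
  vsmooth_at Y p ->
  D Y p (\sum_(i <- r) a i *: w i) = \sum_(i <- r) a i *: D Y p (w i).
Proof.
move=> Ys; elim: r => [|i r IHr]; first by rewrite !big_nil conn_dir0.
by rewrite !big_cons (conn_linear Dc)// IHr.
Qed.

Lemma msmooth_tcoord Y p j : vsmooth_at Y p ->
  msmooth_at (fun q => (tcoord (chart_at p) q (Y q)) 0 j) p.
Proof. by move=> Ys; apply: smooth_at_coord Ys. Qed.

Lemma near_tcoord_expand c p Y : cdom c p ->
  {near p, Y =1 fun q => \sum_j (tcoord c q (Y q)) 0 j *: coord_field c j q}.
Proof. by move=> cp; apply: filterS (near_cdom cp) => q cq; exact: tcoord_expand. Qed.

(** The expression of [D] by Christoffel symbols, with the [D (coord_field _ j)]
    kept as vectors. *)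
Lemma conn_expand Y p v : vsmooth_at Y p ->
  D Y p v = mderiv (fun q => tcoord (chart_at p) q (Y q)) p v
    + \sum_j (Y p) 0 j *: D (coord_field (chart_at p) j) p v.
Proof.
move=> Ys; have cp := cdom_chart_at p.
have Cs j : vsmooth_at (coord_field (chart_at p) j) p by exact: coord_field_smooth.
rewrite (conn_local v (near_tcoord_expand Y cp) Ys) conn_sum => [|j]; last first.
  by apply: vsmoothZ => //; exact: msmooth_tcoord.
under eq_bigr => j _ do rewrite (conn_leibniz Dc v (msmooth_tcoord j Ys) (Cs j))
   tcoord_chart_at coord_field_chart_at.
rewrite big_split; congr (_ + _).
have dY := msmooth_mdiff Ys.
rewrite [RHS]row_sum_delta; apply: eq_bigr => j _; congr (_ *: _).
by rewrite (mderiv_is_mdiff (is_diff_coord 0 j dY)).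
Qed.

End Connection.

(** * The Lie bracket as a commutator *)

Lemma partial_sym (R : realType) d (f : 'rV[R]_d -> R) x j k :
  smooth_at f x -> partial k (partial j f) x = partial j (partial k f) x.
Proof.
move=> fs; have df := smooth_at_differentiable fs.
have E l : {near x, partial l f =1 fun y => 'd f y (delta_mx 0 l)}.
  by apply: filterS df => y dfy; rewrite (partial_is_diff l (differentiableP dfy)).
have dE l : is_diff x (fun y => 'd f y (delta_mx 0 l)) ('d (partial l f) x).
  apply: near_eq_is_diff (E l) _; apply/differentiableP.
  by apply: smooth_at_differentiable1; exact: smooth_at_partial.
have dp l l' : partial l' (partial l f) x
    = 'd (fun y => 'd f y (delta_mx 0 l)) x (delta_mx 0 l').
  have [_ ->] := dE l; rewrite (partial_is_diff l' (differentiableP _))//.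
  by apply: smooth_at_differentiable1; exact: smooth_at_partial.
have [dj _] := dE j; have [dk _] := dE k.
by rewrite !dp; exact: (diff_diff_sym df dj dk).
Qed.

Section Bracket.
Variables (R : realType) (d : nat) (N : manifold R d).
Implicit Types (c : chart N) (p q : N) (X Y W : N -> 'rV[R]_d).

Let vhat p Y q := tcoord (chart_at p) q (Y q).

(** [mderiv f q] refers to the chart at [q]; near [p], the derivative of [f]
    along [Y] is thereby read in the single chart at [p]. *)
Lemma near_mderiv_field (f : N -> R) Y p : msmooth_at f p ->
  {near cmap (chart_at p) p, (fun x => \sum_j
      (vhat p Y \o cinv (chart_at p)) x 0 j
      * partial j (f \o cinv (chart_at p)) x)
    =1 (fun q => mderiv f q (Y q)) \o cinv (chart_at p)}.
Proof.
move=> fs; set c := chart_at p; have cp : cdom c p := cdom_chart_at p.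
near=> x.
have cx : cdom c (cinv c x) by near: x; exact: near_cinv (near_cdom cp).
have xK : cmap c (cinv c x) = x by near: x; exact: near_cinvK.
have dfx : differentiable (f \o cinv c) x.
  by near: x; exact: smooth_at_differentiable fs.
have : is_diff (cmap c (cinv c x)) (f \o cinv c) ('d (f \o cinv c) x) by rewrite xK.
move=> /(is_mdiff_chart cx)/mderiv_is_mdiff /= ->.
rewrite (diff_partialE _ dfx); exact: eq_bigr.
Unshelve. all: by end_near. Qed.

Lemma msmooth_mderiv_field (f : N -> R) Y p :
  msmooth_at f p -> vsmooth_at Y p -> msmooth_at (fun q => mderiv f q (Y q)) p.
Proof.
move=> fs Ys; apply: near_eq_smooth_at (near_mderiv_field Y fs) _.
apply: smooth_at_sum => j; apply: smooth_atM.
  exact: smooth_at_coord Ys.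
exact: smooth_at_partial fs.
Qed.

Lemma is_mdiff_mderiv_field (f : N -> R) Y p :
  msmooth_at f p -> mdiff (vhat p Y) p ->
  is_mdiff (fun q => mderiv f q (Y q)) p
    (fun v => mderiv f p (mderiv (vhat p Y) p v)
       + \sum_j \sum_k Y p 0 j * v 0 k *
         partial k (partial j (f \o cinv (chart_at p))) (cmap (chart_at p) p)).
Proof.
move=> fs dY; set c := chart_at p; set x0 := cmap c p; set fh := f \o cinv c.
have cp : cdom c p := cdom_chart_at p.
have dfh := smooth_at_differentiable1 fs.
apply: near_eq_is_diff (near_mderiv_field Y fs) _.
have dp j : is_diff x0 (partial j fh) ('d (partial j fh) x0).
  apply/differentiableP/smooth_at_differentiable1; exact: smooth_at_partial fs.
apply: is_diff_eq (is_diff_sumf _ (fun j => is_diff_mul (is_diff_coord 0 j dY) (dp j))) _.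
apply/funext => v; rewrite big_split /=; congr (_ + _).
  by rewrite /mderiv (diff_partialE _ dfh).
apply: eq_bigr => j _; rewrite /vhat /= (cmapK cp) tcoord_chart_at.
rewrite (diff_partialE v) ?big_distrr/=; last by case: (dp j).
by apply: eq_bigr => k _; rewrite mulrA.
Qed.

(** The second derivatives of [f] contribute symmetrically in [X] and [Y]; what
    remains are the derivatives of the components of the fields. *)
Lemma mderiv_lie_bracket (f : N -> R) X Y p :
  msmooth_at f p -> mdiff (vhat p X) p -> mdiff (vhat p Y) p ->
  mderiv (fun q => mderiv f q (Y q)) p (X p)
  - mderiv (fun q => mderiv f q (X q)) p (Y p)
  = mderiv f p (lie_bracket X Y p).
Proof.
move=> fs dX dY; rewrite (mderiv_is_mdiff (is_mdiff_mderiv_field fs dX)).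
rewrite (mderiv_is_mdiff (is_mdiff_mderiv_field fs dY)).
rewrite /lie_bracket -/(vhat p X) -/(vhat p Y).
rewrite [mderiv f p (_ - _)]linearB /= -!/(mderiv f p _).
rewrite opprD addrACA -[RHS]addr0; congr (_ + _); apply/eqP; rewrite subr_eq0.
apply/eqP; rewrite exchange_big; apply: eq_bigr => j _; apply: eq_bigr => k _.
by rewrite (partial_sym _ _ fs) [Y p 0 k * _]mulrC.
Qed.

End Bracket.

(** * Product rules on a manifold *)

Section MderivRules.
Variables (R : realType) (d : nat) (N : manifold R d).
Implicit Types (p q : N).

Lemma is_mdiffD (V : normedModType R) (F G : N -> V) p dF dG :
  is_mdiff F p dF -> is_mdiff G p dG ->
  is_mdiff (fun q => F q + G q) p (fun v => dF v + dG v).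
Proof. exact: is_diffD. Qed.

Lemma is_mdiffM (f g : N -> R) p df dg :
  is_mdiff f p df -> is_mdiff g p dg ->
  is_mdiff (fun q => f q * g q) p (fun v => df v * g p + f p * dg v).
Proof.
move=> fd gd; have := is_diff_mul fd gd; rewrite /= cmapK//.
exact: cdom_chart_at.
Qed.

Lemma is_mdiffZ n (f : N -> R) (g : N -> 'rV[R]_n) p df dg :
  is_mdiff f p df -> is_mdiff g p dg ->
  is_mdiff (fun q => f q *: g q) p (fun v => df v *: g p + f p *: dg v).
Proof.
move=> fd gd; have := is_diff_scale fd gd; rewrite /= cmapK//.
exact: cdom_chart_at.
Qed.

Lemma is_mdiff_sum (V : normedModType R) (I : Type) (r : seq I)
    (F : I -> N -> V) dF p :
  (forall i, is_mdiff (F i) p (dF i)) ->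
  is_mdiff (fun q => \sum_(i <- r) F i q) p (fun v => \sum_(i <- r) dF i v).
Proof. by move=> H; exact: (is_diff_sumf r H). Qed.

Lemma is_mdiff_cmap c p : cdom c p -> is_mdiff (@cmap _ _ N c) p (tcoord c p).
Proof.
move=> cp; apply: (is_mdiff_chart (dF := id) cp).
apply: near_eq_is_diff (is_diff_id _).
by apply: filterS (near_cinvK cp) => x /= ->.
Qed.

Lemma lie_bracket_coord_field c p j k : cdom c p -> chart_at p = c ->
  lie_bracket (coord_field c j) (coord_field c k) p = 0.
Proof.
move=> cp <-.
have dcf l v : mderiv (fun q => tcoord (chart_at p) q (coord_field (chart_at p) l q)) p v = 0.
  have E : {near p, (fun=> delta_mx 0 l) =1
      (fun q => tcoord (chart_at p) q (coord_field (chart_at p) l q))}.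
    apply: filterS (near_cdom (cdom_chart_at p)) => q cq.
    by rewrite tcoord_coord_field// transition_jacobian1// mulmx1.
  by rewrite (mderiv_is_mdiff (near_eq_is_mdiff E (is_mdiff_cst _ _))).
by rewrite /lie_bracket !dcf subrr.
Qed.

End MderivRules.

(** * Pull-back of a connection along an immersion *)

Section Pullback.
Variables (R : realType) (d k : nat) (N : manifold R d) (M : manifold R k).
Variables (i : M -> N) (M_sub : immersion i).
Variables (D : cov_op N) (Dc : connection D).
Implicit Types (p q : M) (Z W : M -> 'rV[R]_d).

Let iC : continuous i := imm_continuous M_sub.

Lemma is_mdiff_immersion (V : normedModType R) (F : N -> V) q dF :
  is_mdiff F (i q) dF -> is_mdiff (F \o i) q (fun v => dF (tmap i q v)).
Proof.
move=> FdF; have cq := cdom_chart_at q; have ciq := cdom_chart_at (i q).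
have L : is_diff (cmap (chart_at q) q) (local_expr i q) (tmap i q).
  apply: DiffDef; first exact: smooth_at_differentiable1 (imm_smooth M_sub q).
  by apply/funext => v; rewrite /tmap mul_rV_lin1.
have Lq : local_expr i q (cmap (chart_at q) q) = cmap (chart_at (i q)) (i q).
  by rewrite /local_expr /= cmapK.
have F' : is_diff (local_expr i q (cmap (chart_at q) q)) (F \o cinv (chart_at (i q))) dF.
  by rewrite Lq.
apply: near_eq_is_diff (is_diff_comp L F').
have := near_cinv cq (iC (near_cdom ciq)).
move=> H; near=> x => /=; rewrite /local_expr /= cmapK//; near: x; exact: H.
Unshelve. all: by end_near. Qed.

(** [Z q] is tangent to [N] at [i q]; [adiff Z p] is differentiability at [p]
    of its components in the chart around [i p]. *)
Definition acomp (c : chart N) Z q : 'rV[R]_d := tcoord c (i q) (Z q).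
Definition adiff Z p := mdiff (acomp (chart_at (i p)) Z) p.

Local Notation Di := (pullback_cov i D).

Lemma pullback_covE Z p v : Di Z p v = mderiv (acomp (chart_at (i p)) Z) p v
  + \sum_j Z p 0 j *: D (coord_field (chart_at (i p)) j) (i p) (tmap i p v).
Proof. by []. Qed.

Lemma near_eq_adiff Z W p : {near p, Z =1 W} -> adiff Z p -> adiff W p.
Proof.
by move=> ZW; apply: near_eq_mdiff; apply: filterS ZW => q; rewrite /acomp => ->.
Qed.

Lemma near_eq_pullback Z W p v : {near p, Z =1 W} -> adiff Z p ->
  Di Z p v = Di W p v.
Proof.
move=> ZW dZ; have ZWp : Z p = W p by exact: (nbhs_singleton ZW).
have E : {near p, acomp (chart_at (i p)) Z =1 acomp (chart_at (i p)) W}.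
  by apply: filterS ZW => q; rewrite /acomp => ->.
by rewrite !pullback_covE ZWp (near_eq_mderiv E dZ).
Qed.

Lemma is_mdiff_acompD Z W p : adiff Z p -> adiff W p ->
  is_mdiff (acomp (chart_at (i p)) (fun q => Z q + W q)) p
   (fun v => mderiv (acomp (chart_at (i p)) Z) p v
     + mderiv (acomp (chart_at (i p)) W) p v).
Proof.
move=> dZ dW; rewrite (_ : acomp _ (fun q => _) = fun q =>
  acomp (chart_at (i p)) Z q + acomp (chart_at (i p)) W q).
  exact: (is_mdiffD dZ dW).
by apply/funext => q; rewrite /acomp tcoordD.
Qed.

Lemma adiffD Z W p : adiff Z p -> adiff W p -> adiff (fun q => Z q + W q) p.
Proof. by move=> dZ dW; exact: is_mdiff_mdiff (is_mdiff_acompD dZ dW). Qed.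

Lemma pullbackD Z W p v : adiff Z p -> adiff W p ->
  Di (fun q => Z q + W q) p v = Di Z p v + Di W p v.
Proof.
move=> dZ dW; rewrite !pullback_covE (mderiv_is_mdiff (is_mdiff_acompD dZ dW)).
rewrite addrACA -big_split /=; under [in LHS]eq_bigr do rewrite mxE scalerDl.
by [].
Qed.

Lemma is_mdiff_acompZ (f : M -> R) Z p df : is_mdiff f p df -> adiff Z p ->
  is_mdiff (acomp (chart_at (i p)) (fun q => f q *: Z q)) p
   (fun v => df v *: Z p + f p *: mderiv (acomp (chart_at (i p)) Z) p v).
Proof.
move=> fd dZ; rewrite (_ : acomp _ (fun q => _) = fun q =>
  f q *: acomp (chart_at (i p)) Z q).
  by have := is_mdiffZ fd dZ; rewrite {2}/acomp tcoord_chart_at.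
by apply/funext => q; rewrite /acomp tcoordZ.
Qed.

Lemma adiffZ (f : M -> R) Z p : mdiff f p -> adiff Z p -> adiff (fun q => f q *: Z q) p.
Proof. by move=> fd dZ; exact: is_mdiff_mdiff (is_mdiff_acompZ fd dZ). Qed.

Lemma pullback_leibniz (f : M -> R) df Z p v : is_mdiff f p df -> adiff Z p ->
  Di (fun q => f q *: Z q) p v = df v *: Z p + f p *: Di Z p v.
Proof.
move=> fd dZ; rewrite !pullback_covE (mderiv_is_mdiff (is_mdiff_acompZ fd dZ)).
rewrite scalerDr addrA scaler_sumr; under eq_bigr do rewrite mxE -scalerA.
by [].
Qed.

Lemma adiff0 p : adiff (fun=> 0) p.
Proof.
rewrite /adiff (_ : acomp _ _ = fun=> 0).
  exact: is_mdiff_mdiff (is_mdiff_cst _ _).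
by apply/funext => q; rewrite /acomp /tcoord mul0mx.
Qed.

Lemma pullback0 p v : Di (fun=> 0) p v = 0.
Proof.
rewrite (near_eq_pullback (W := fun _ : M => (0 : R) *: (0 : 'rV[R]_d)) v _ (adiff0 p)).
  rewrite (pullback_leibniz v (is_mdiff_cst (0 : R) p) (adiff0 p)).
  by rewrite !scale0r addr0.
by apply: filterE => q; rewrite scaler0.
Qed.

Lemma adiff_sum (I : Type) (r : seq I) (Z : I -> M -> 'rV[R]_d) p :
  (forall a, adiff (Z a) p) -> adiff (fun q => \sum_(a <- r) Z a q) p.
Proof.
move=> dZ; elim: r => [|a r IHr].
  rewrite (_ : (fun q => _) = fun=> 0); first exact: adiff0.
  by apply/funext => q; rewrite big_nil.
rewrite (_ : (fun q => _) = fun q => Z a q + \sum_(a <- r) Z a q).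
  exact: (adiffD (dZ a) IHr).
by apply/funext => q; rewrite big_cons.
Qed.

Lemma pullback_sum (I : Type) (r : seq I) (Z : I -> M -> 'rV[R]_d) p v :
  (forall a, adiff (Z a) p) ->
  Di (fun q => \sum_(a <- r) Z a q) p v = \sum_(a <- r) Di (Z a) p v.
Proof.
move=> dZ; elim: r => [|a r IHr].
  rewrite (_ : (fun q => _) = fun=> 0); first by rewrite pullback0 big_nil.
  by apply/funext => q; rewrite big_nil.
rewrite (_ : (fun q => _) = fun q => Z a q + \sum_(a <- r) Z a q).
  by rewrite (pullbackD v (dZ a) (adiff_sum r dZ)) IHr big_cons.
by apply/funext => q; rewrite big_cons.
Qed.

Lemma is_mdiff_acomp_comp (V : N -> 'rV[R]_d) q : vsmooth_at V (i q) ->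
  is_mdiff (acomp (chart_at (i q)) (V \o i)) q (fun v =>
    mderiv (fun y => tcoord (chart_at (i q)) y (V y)) (i q) (tmap i q v)).
Proof.
by move=> Vs; exact: (is_mdiff_immersion (msmooth_mdiff Vs)).
Qed.

Lemma adiff_comp (V : N -> 'rV[R]_d) q : vsmooth_at V (i q) -> adiff (V \o i) q.
Proof. by move=> Vs; exact: is_mdiff_mdiff (is_mdiff_acomp_comp Vs). Qed.

(** This links the pull-back connection to [D], and it holds although
    [pullback_cov] only refers to the values of [D] on coordinate fields: both
    sides obey the Leibniz rule on the coordinate expansion of [V]. *)
Lemma pullback_comp (V : N -> 'rV[R]_d) q v : vsmooth_at V (i q) ->
  Di (V \o i) q v = D V (i q) (tmap i q v).
Proof.
move=> Vs; rewrite pullback_covE (mderiv_is_mdiff (is_mdiff_acomp_comp Vs)).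
by rewrite (conn_expand Dc).
Qed.

Lemma near_immersion_cdom c p : cdom c (i p) -> \forall q \near p, cdom c (i q).
Proof. by move=> cp; exact: iC (near_cdom cp). Qed.

Lemma acomp_expand c Z p : cdom c (i p) -> {near p, Z =1 fun q =>
  \sum_j acomp c Z q 0 j *: coord_field c j (i q)}.
Proof.
by move=> cp; apply: filterS (near_immersion_cdom cp) => q cq; exact: tcoord_expand.
Qed.

(** The chart [c] need not be the one at [i q]: it can stay fixed while [q]
    moves, which is what differentiating the result once more requires. *)
Lemma pullback_expand c Z q (da : 'I_d -> 'rV[R]_k -> R) v : cdom c (i q) ->
  (forall j, is_mdiff (fun q => acomp c Z q 0 j) q (da j)) ->
  adiff Z q /\
  Di Z q v = \sum_j (da j v *: coord_field c j (i q)
    + acomp c Z q 0 j *: D (coord_field c j) (i q) (tmap i q v)).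
Proof.
move=> cq dZ.
have Cs j := coord_field_smooth j cq.
have dT j : adiff (fun q => acomp c Z q 0 j *: coord_field c j (i q)) q.
  apply: adiffZ; first exact: is_mdiff_mdiff (dZ j).
  exact: adiff_comp (Cs j).
have dS := adiff_sum (index_enum 'I_d) dT.
have E := acomp_expand Z cq.
have E' : {near q, (fun q => \sum_j acomp c Z q 0 j *: coord_field c j (i q)) =1 Z}.
  by apply: filterS E => y <-.
split; first exact: near_eq_adiff E' dS.
rewrite -(near_eq_pullback v E' dS) pullback_sum//; apply: eq_bigr => j _.
rewrite (pullback_leibniz v (dZ j) (adiff_comp (Cs j))).
by rewrite -(pullback_comp v (Cs j)).
Qed.

End Pullback.

(** * Torsion and curvature of the pull-back *)

Lemma msmooth_near_mdiff (R : realType) k (M : manifold R k)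
    (V : normedModType R) (F : M -> V) p :
  msmooth_at F p -> \forall q \near p, mdiff F q.
Proof.
move=> Fs; have cp := cdom_chart_at p.
have dF := near_cmap cp (smooth_at_differentiable Fs).
near=> q.
have cq : cdom (chart_at p) q by near: q; exact: near_cdom.
have dFq : differentiable (F \o cinv (chart_at p)) (cmap (chart_at p) q).
  by near: q; exact: dF.
exact: is_mdiff_mdiff (is_mdiff_chart cq (differentiableP dFq)).
Unshelve. all: by end_near. Qed.

(** The cancellations in the curvature of a pull-back, for one component [a]
    of the field: [Xa] and [Ya] are its derivatives, [A1] and [A2] its second
    derivatives in the two orders. *)
Lemma commutator_algebra (R : comPzRingType) d
    (a Xa Ya A1 A2 : R) (e s1 s2 t1 t2 r1 r2 : 'rV[R]_d) :
  (A1 *: e + Ya *: s1 + (Xa *: s2 + a *: (t1 + r1)))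
  - (A2 *: e + Xa *: s2 + (Ya *: s1 + a *: (t2 + r2)))
  - ((A1 - A2) *: e + a *: (t1 - t2)) = a *: (r1 - r2).
Proof. by apply/rowP => l; rewrite !mxE; ring. Qed.

Section PullbackCurvature.
Variables (R : realType) (d k : nat) (N : manifold R d) (M : manifold R k).
Variables (i : M -> N) (M_sub : immersion i).
Variables (D : cov_op N) (Dc : connection D).
Implicit Types (p q : M) (Z W : M -> 'rV[R]_d) (X Y : M -> 'rV[R]_k).

Local Notation Di := (pullback_cov i D).
Local Notation ichart p := (chart_at (i p)).

Definition tfield X q : 'rV[R]_d := tmap i q (X q).

Lemma tmapD p v w : tmap i p (v + w) = tmap i p v + tmap i p w.
Proof. exact: mulmxDl. Qed.

Lemma tmapZ p a v : tmap i p (a *: v) = a *: tmap i p v.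
Proof. by rewrite /tmap -scalemxAl. Qed.

Lemma tmapN p v : tmap i p (- v) = - tmap i p v.
Proof. by rewrite /tmap mulNmx. Qed.

Lemma tcoord_tmap c q v b : cdom c (i q) ->
  tcoord c (i q) (tmap i q v) 0 b = mderiv (fun q => cmap c (i q) 0 b) q v.
Proof.
move=> cq; have H := is_mdiff_immersion M_sub (is_mdiff_cmap cq).
by rewrite (mderiv_is_mdiff (is_diff_coord 0 b H : is_mdiff _ q _)).
Qed.

Lemma msmooth_cmap_immersion p b :
  msmooth_at (fun q => cmap (ichart p) (i q) 0 b) p.
Proof. exact: (smooth_at_coord 0 b (imm_smooth M_sub p)). Qed.

Lemma near_acomp_tfield X p b :
  {near p, (fun q => mderiv (fun q => cmap (ichart p) (i q) 0 b) q (X q))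
    =1 fun q => acomp i (ichart p) (tfield X) q 0 b}.
Proof.
apply: filterS (near_immersion_cdom M_sub (cdom_chart_at (i p))) => q cq.
by rewrite /acomp /tfield tcoord_tmap.
Qed.

Lemma is_mdiff_mderiv (f : M -> R) X p : msmooth_at f p -> vsmooth_at X p ->
  mdiff (fun q => mderiv f q (X q)) p.
Proof.
move=> fs Xs; exact: is_mdiff_mdiff (is_mdiff_mderiv_field fs (msmooth_mdiff Xs)).
Qed.

Lemma is_mdiff_acomp_tfield X p b : vsmooth_at X p ->
  is_mdiff (fun q => acomp i (ichart p) (tfield X) q 0 b) p
   (mderiv (fun q => mderiv (fun q => cmap (ichart p) (i q) 0 b) q (X q)) p).
Proof.
move=> Xs; apply: near_eq_is_mdiff (near_acomp_tfield X p b) _.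
exact: is_mdiff_mderiv (msmooth_cmap_immersion p b) Xs.
Qed.

Lemma adiff_tfield X p : vsmooth_at X p -> adiff i (tfield X) p.
Proof.
move=> Xs.
have [] // := pullback_expand M_sub Dc 0 (cdom_chart_at (i p))
  (fun b => is_mdiff_acomp_tfield b Xs).
Qed.

Lemma msmooth_acomp_tfield X p : vsmooth_at X p ->
  msmooth_at (acomp i (ichart p) (tfield X)) p.
Proof.
move=> Xs; apply: smooth_at_row => b.
apply: (near_eq_msmooth (near_acomp_tfield X p b)).
exact: msmooth_mderiv_field (msmooth_cmap_immersion p b) Xs.
Qed.

(** Torsion-freeness is inherited: the components of [tfield X] in a chart of
    [N] are the derivatives along [X] of the components of the map [i]. *)
Lemma pullback_torsion X Y p :
  (forall (V W : N -> 'rV[R]_d) y, vsmooth_at V y -> vsmooth_at W y ->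
    D W y (V y) - D V y (W y) = lie_bracket V W y) ->
  vsmooth_at X p -> vsmooth_at Y p ->
  Di (tfield Y) p (X p) - Di (tfield X) p (Y p)
  = tmap i p (lie_bracket X Y p).
Proof.
move=> Dt Xs Ys; have cp := cdom_chart_at (i p); set c := ichart p.
have [_ ->] := pullback_expand M_sub Dc (X p) cp (fun b => is_mdiff_acomp_tfield b Ys).
have [_ ->] := pullback_expand M_sub Dc (Y p) cp (fun b => is_mdiff_acomp_tfield b Xs).
rewrite !big_split /= opprD addrACA -sumrB.
have -> : \sum_(j < d) acomp i c (tfield Y) p 0 j *: D (coord_field c j) (i p) (tmap i p (X p))
   - \sum_(j < d) acomp i c (tfield X) p 0 j *: D (coord_field c j) (i p) (tmap i p (Y p)) = 0.
  have E (U W : M -> 'rV[R]_k) : \sum_(j < d) acomp i c (tfield W) p 0 j *: D (coord_field c j) (i p) (tmap i p (U p))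
      = \sum_j \sum_l (acomp i c (tfield W) p 0 j * acomp i c (tfield U) p 0 l)
          *: D (coord_field c j) (i p) (coord_field c l (i p)).
    apply: eq_bigr => j _.
    rewrite {1}(tcoord_expand (tmap i p (U p)) cp) (conn_dir_sum Dc); last first.
      exact: coord_field_smooth.
    by rewrite scaler_sumr; apply: eq_bigr => l _; rewrite scalerA.
  apply/eqP; rewrite subr_eq0; apply/eqP; rewrite (E X Y) (E Y X) [RHS]exchange_big.
  apply: eq_bigr => j _; apply: eq_bigr => l _; rewrite mulrC; congr (_ *: _).
  apply/eqP; rewrite -subr_eq0; apply/eqP.
  rewrite Dt; [|exact: coord_field_smooth|exact: coord_field_smooth].
  exact: lie_bracket_coord_field.
rewrite addr0 (tcoord_expand (tmap i p (lie_bracket X Y p)) cp).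
apply: eq_bigr => b _; rewrite -scalerBl; congr (_ *: _).
rewrite tcoord_tmap//; apply: mderiv_lie_bracket.
- exact: msmooth_cmap_immersion.
- exact: msmooth_mdiff Xs.
- exact: msmooth_mdiff Ys.
Qed.

Section SecondDerivative.
Variables (p : M) (Z : M -> 'rV[R]_d).
Hypothesis Zs : msmooth_at (acomp i (ichart p) Z) p.
Let c := ichart p.
Let cp : cdom c (i p) := cdom_chart_at (i p).
Let a (j : 'I_d) q : R := acomp i c Z q 0 j.
Let f (b : 'I_d) q : R := cmap c (i q) 0 b.
Let G (j b : 'I_d) (y : N) : 'rV[R]_d := D (coord_field c j) y (coord_field c b y).

Let as_ j : msmooth_at (a j) p.
Proof. exact: (smooth_at_coord 0 j Zs). Qed.

Let Gs j b : vsmooth_at (G j b) (i p).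
Proof. by apply: (conn_smooth Dc); exact: coord_field_smooth. Qed.

Let near_pullback Y : {near p, (fun q => \sum_j
    (mderiv (a j) q (Y q) *: (coord_field c j \o i) q
     + a j q *: \sum_b mderiv (f b) q (Y q) *: (G j b \o i) q))
  =1 fun q => Di Z q (Y q)}.
Proof.
have am : \forall q \near p, mdiff (acomp i c Z) q := msmooth_near_mdiff Zs.
near=> q.
have cq : cdom c (i q) by near: q; exact: near_immersion_cdom.
have aq j : is_mdiff (a j) q (mderiv (a j) q).
  have H : mdiff (acomp i c Z) q by near: q; exact: am.
  exact: (is_mdiff_mdiff (is_diff_coord 0 j H)).
have [_ ->] := pullback_expand M_sub Dc (Y q) cq aq.
apply: eq_bigr => j _; congr (_ + _ *: _).
rewrite {1}(tcoord_expand (tmap i q (Y q)) cq) (conn_dir_sum Dc); last first.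
  exact: coord_field_smooth.
by apply: eq_bigr => b _; rewrite tcoord_tmap.
Unshelve. all: by end_near. Qed.

(** Near [p] the field is a combination of the pulled back fields
    [coord_field c j \o i] and [G j b \o i]; [pullback_comp] applies to each
    of them. *)
Lemma pullback_pullback Y : vsmooth_at Y p ->
  adiff i (fun q => Di Z q (Y q)) p /\
  forall u, Di (fun q => Di Z q (Y q)) p u = \sum_j
    (mderiv (fun q => mderiv (a j) q (Y q)) p u *: coord_field c j (i p)
     + mderiv (a j) p (Y p) *: D (coord_field c j) (i p) (tmap i p u)
     + (mderiv (a j) p u *: \sum_b mderiv (f b) p (Y p) *: G j b (i p)
        + a j p *: \sum_b
            (mderiv (fun q => mderiv (f b) q (Y q)) p u *: G j b (i p)
             + mderiv (f b) p (Y p) *: D (G j b) (i p) (tmap i p u)))).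
Proof.
move=> Ys.
have dYa j := is_mdiff_mderiv (as_ j) Ys.
have dYf b := is_mdiff_mderiv (msmooth_cmap_immersion p b) Ys.
have dC j : adiff i (coord_field c j \o i) p.
  by apply: (adiff_comp M_sub); exact: coord_field_smooth.
have dG j b : adiff i (G j b \o i) p by apply: (adiff_comp M_sub); exact: Gs.
have d1 j := adiffZ (dYa j) (dC j).
have d2 j b := adiffZ (dYf b) (dG j b).
have d3 j := adiff_sum (index_enum 'I_d) (d2 j).
have da j := msmooth_mdiff (as_ j).
have d4 j := adiffZ (da j) (d3 j).
have d5 j := adiffD (d1 j) (d4 j).
have d6 := adiff_sum (index_enum 'I_d) d5.
split=> [|u]; first exact: near_eq_adiff (near_pullback Y) d6.
rewrite -(near_eq_pullback D u (near_pullback Y) d6).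
rewrite (pullback_sum D _ u d5); apply: eq_bigr => j _.
rewrite (pullbackD D u (d1 j) (d4 j)).
rewrite (pullback_leibniz D u (dYa j) (dC j)) (pullback_leibniz D u (da j) (d3 j)).
rewrite (pullback_comp M_sub Dc); last exact: coord_field_smooth.
rewrite (pullback_sum D _ u (d2 j)).
congr (_ + (_ + _ *: _)); apply: eq_bigr => b _.
rewrite (pullback_leibniz D u (dYf b) (dG j b)).
by rewrite (pullback_comp M_sub Dc _ (Gs j b)).
Qed.

End SecondDerivative.

(** In the commutator of two expansions [pullback_pullback], the products of
    first derivatives cancel in pairs, and the second derivatives combine with
    the bracket term by [mderiv_lie_bracket].  Only the derivatives of the
    [G j b] remain, and these make up the curvature of [D] on coordinate fields,
    whose brackets vanish. *)
Lemma pullback_curvature X Y Z p :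
  vsmooth_at X p -> vsmooth_at Y p -> msmooth_at (acomp i (ichart p) Z) p ->
  Di (fun q => Di Z q (Y q)) p (X p) - Di (fun q => Di Z q (X q)) p (Y p)
    - Di Z p (lie_bracket X Y p)
  = \sum_j \sum_a \sum_b
     (Z p 0 j * tmap i p (X p) 0 a * tmap i p (Y p) 0 b) *:
     curvature D (coord_field (ichart p) a) (coord_field (ichart p) b)
       (coord_field (ichart p) j) (i p).
Proof.
move=> Xs Ys Zs; have cp := cdom_chart_at (i p); set c := ichart p.
have Cs j : vsmooth_at (coord_field c j) (i p) by exact: coord_field_smooth.
pose f (b : 'I_d) q : R := cmap c (i q) 0 b.
pose G (j b : 'I_d) (y : N) : 'rV[R]_d := D (coord_field c j) y (coord_field c b y).
have Gs j b : vsmooth_at (G j b) (i p) by exact: (conn_smooth Dc).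
have as_ j : msmooth_at (fun q => acomp i c Z q 0 j) p.
  exact: (smooth_at_coord 0 j Zs).
have [_ ->] := pullback_pullback Zs Ys; have [_ ->] := pullback_pullback Zs Xs.
have da j := msmooth_mdiff (as_ j).
have [_ ->] := pullback_expand M_sub Dc (lie_bracket X Y p) cp da.
have tE v : tmap i p v = \sum_b mderiv (f b) p v *: coord_field c b (i p).
  rewrite {1}(tcoord_expand (tmap i p v) cp); apply: eq_bigr => b _.
  by rewrite tcoord_tmap.
have VE (W : N -> 'rV[R]_d) v : vsmooth_at W (i p) ->
    D W (i p) (tmap i p v) = \sum_b mderiv (f b) p v *: D W (i p) (coord_field c b (i p)).
  by move=> Ws; rewrite tE (conn_dir_sum Dc).
rewrite -!sumrB; apply: eq_bigr => j _.
have fX b v : mderiv (f b) p v = tmap i p v 0 b.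
  by rewrite -tcoord_tmap// tcoord_chart_at.
rewrite -/c (VE (coord_field c j) (X p))// (VE (coord_field c j) (Y p))//.
rewrite (VE (coord_field c j) (lie_bracket X Y p))//.
rewrite -!/(G j _) -!/(G j _ _).
have -> : \sum_(b < d) mderiv (f b) p (lie_bracket X Y p) *:
     D (coord_field c j) (i p) (coord_field c b (i p))
   = \sum_b mderiv (fun q => mderiv (f b) q (Y q)) p (X p) *: G j b (i p)
   - \sum_b mderiv (fun q => mderiv (f b) q (X q)) p (Y p) *: G j b (i p).
  rewrite -sumrB; apply: eq_bigr => b _; rewrite -scalerBl; congr (_ *: _).
  symmetry; apply: mderiv_lie_bracket; last 2 first.
  - exact: msmooth_mdiff Xs.
  - exact: msmooth_mdiff Ys.
  exact: msmooth_cmap_immersion.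
rewrite -(mderiv_lie_bracket (as_ j) (msmooth_mdiff Xs) (msmooth_mdiff Ys)).
rewrite !big_split /=.
rewrite commutator_algebra; under eq_bigr do rewrite (VE (G j _))// fX.
rewrite [X in _ *: (_ - X)](_ : _ = \sum_b \sum_a
    (tmap i p (X p) 0 a * tmap i p (Y p) 0 b) *: D (G j a) (i p) (coord_field c b (i p))).
  rewrite [X in _ *: (X - _)](_ : _ = \sum_b \sum_a
    (tmap i p (X p) 0 a * tmap i p (Y p) 0 b) *: D (G j b) (i p) (coord_field c a (i p))).
    rewrite exchange_big [X in _ *: (_ - X)]exchange_big -sumrB scaler_sumr.
    apply: eq_bigr => a _; rewrite -sumrB scaler_sumr; apply: eq_bigr => b _.
    rewrite /acomp tcoord_chart_at -scalerBr scalerA mulrA; congr (_ *: _).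
    rewrite /curvature lie_bracket_coord_field// (conn_dir0 Dc)// subr0//.
  apply: eq_bigr => b _; rewrite scaler_sumr; apply: eq_bigr => a _.
  by rewrite fX scalerA mulrC.
rewrite exchange_big; apply: eq_bigr => a _; rewrite (VE (G j a))// scaler_sumr fX.
by apply: eq_bigr => b _; rewrite fX scalerA.
Qed.

End PullbackCurvature.

(** * Algebra of the structure tensors *)

Section MetricAlgebra.
Variables (R : realType) (d : nat) (N : manifold R d) (S : acm_structure N).
Implicit Types (p : N) (u v w : 'rV[R]_d).

Lemma gm_lin1 p a u v w : gm S p (a *: u + v) w = a * gm S p u w + gm S p v w.
Proof. by rewrite /gm /pairing !mulmxDl -!scalemxAl !mxE. Qed.

Lemma gm_lin2 p a u v w : gm S p w (a *: u + v) = a * gm S p w u + gm S p w v.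
Proof.
by rewrite /gm /pairing linearD linearZ mulmxDr -scalemxAr !mxE.
Qed.

Lemma gmDl p u v w : gm S p (u + v) w = gm S p u w + gm S p v w.
Proof. by have := gm_lin1 p 1 u v w; rewrite scale1r mul1r. Qed.
Lemma gmDr p u v w : gm S p w (u + v) = gm S p w u + gm S p w v.
Proof. by have := gm_lin2 p 1 u v w; rewrite scale1r mul1r. Qed.
Lemma gm0l p w : gm S p 0 w = 0.
Proof. by rewrite /gm /pairing !mul0mx mxE. Qed.
Lemma gm0r p w : gm S p w 0 = 0.
Proof. by rewrite /gm /pairing trmx0 mulmx0 mxE. Qed.
Lemma gmZl p a u w : gm S p (a *: u) w = a * gm S p u w.
Proof. by have := gm_lin1 p a u 0 w; rewrite gm0l !addr0. Qed.
Lemma gmZr p a u w : gm S p w (a *: u) = a * gm S p w u.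
Proof. by have := gm_lin2 p a u 0 w; rewrite gm0r !addr0. Qed.
Lemma gmNl p u w : gm S p (- u) w = - gm S p u w.
Proof. by rewrite -scaleN1r gmZl mulN1r. Qed.
Lemma gmNr p u w : gm S p w (- u) = - gm S p w u.
Proof. by rewrite -scaleN1r gmZr mulN1r. Qed.
Lemma gm_suml p (I : Type) (r : seq I) (u : I -> 'rV[R]_d) w :
  gm S p (\sum_(a <- r) u a) w = \sum_(a <- r) gm S p (u a) w.
Proof.
elim: r => [|a r IHr]; first by rewrite !big_nil gm0l.
by rewrite !big_cons gmDl IHr.
Qed.
Lemma gm_sumr p (I : Type) (r : seq I) (u : I -> 'rV[R]_d) w :
  gm S p w (\sum_(a <- r) u a) = \sum_(a <- r) gm S p w (u a).
Proof.
elim: r => [|a r IHr]; first by rewrite !big_nil gm0r.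
by rewrite !big_cons gmDr IHr.
Qed.

Lemma phi_lin p a u v : phi S p (a *: u + v) = a *: phi S p u + phi S p v.
Proof. by rewrite /phi mulmxDl -scalemxAl. Qed.

Lemma eta_lin p a u v : eta S p (a *: u + v) = a * eta S p u + eta S p v.
Proof. by rewrite /eta mulmxDl -scalemxAl !mxE. Qed.

Definition gssf_tensor (f1 f2 f3 : N -> R) p x y z : 'rV[R]_d :=
  f1 p *: (gm S p y z *: x - gm S p x z *: y)
  + f2 p *: (gm S p x (phi S p z) *: phi S p y - gm S p y (phi S p z) *: phi S p x
             + (2 * gm S p x (phi S p y)) *: phi S p z)
  + f3 p *: ((eta S p x * eta S p z) *: y - (eta S p y * eta S p z) *: x
             + (gm S p x z * eta S p y) *: xi S p
             - (gm S p y z * eta S p x) *: xi S p).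

Lemma gssf_tensor_lin1 f1 f2 f3 p a x x' y z :
  gssf_tensor f1 f2 f3 p (a *: x + x') y z
  = a *: gssf_tensor f1 f2 f3 p x y z + gssf_tensor f1 f2 f3 p x' y z.
Proof.
rewrite /gssf_tensor !gm_lin1 !eta_lin phi_lin.
by apply/rowP => l; rewrite !mxE; ring.
Qed.

Lemma gssf_tensor_lin2 f1 f2 f3 p a x y y' z :
  gssf_tensor f1 f2 f3 p x (a *: y + y') z
  = a *: gssf_tensor f1 f2 f3 p x y z + gssf_tensor f1 f2 f3 p x y' z.
Proof.
rewrite /gssf_tensor !phi_lin !gm_lin1 !gm_lin2 !eta_lin.
by apply/rowP => l; rewrite !mxE; ring.
Qed.

Lemma gssf_tensor_lin3 f1 f2 f3 p a x y z z' :
  gssf_tensor f1 f2 f3 p x y (a *: z + z')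
  = a *: gssf_tensor f1 f2 f3 p x y z + gssf_tensor f1 f2 f3 p x y z'.
Proof.
rewrite /gssf_tensor !phi_lin !gm_lin2 !eta_lin.
by apply/rowP => l; rewrite !mxE; ring.
Qed.

End MetricAlgebra.

Lemma linear_row_expand (R : pzRingType) d (V : lmodType R)
    (F : 'rV[R]_d -> V) (v : 'rV[R]_d) :
  (forall a u w, F (a *: u + w) = a *: F u + F w) ->
  F v = \sum_j v 0 j *: F (delta_mx 0 j).
Proof.
move=> Fl; have F0 : F 0 = 0.
  by apply: (addrI (F 0)); have := Fl 1 0 0; rewrite !scale1r !addr0 => <-.
rewrite [in LHS](row_sum_delta v); elim: (index_enum _) => [|j r IHr].
  by rewrite !big_nil.
by rewrite !big_cons Fl IHr.
Qed.

(** * The semisymmetric metric connection along the submanifold *)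

Section PullbackMetric.
Variables (R : realType) (d k : nat) (N : manifold R d) (M : manifold R k).
Variables (i : M -> N) (M_sub : immersion i).
Variables (S : acm_structure N) (D : cov_op N).
Hypothesis D_lc : levi_civita (acm_g S) D.
Hypothesis S_metric : riemannian_metric (acm_g S).
Implicit Types (p q : M) (Z W : M -> 'rV[R]_d) (X Y : M -> 'rV[R]_k).

Let Dc := lc_connection D_lc.
Local Notation Di := (pullback_cov i D).
Local Notation ichart p := (chart_at (i p)).

Lemma gmC (y : N) v w : gm S y v w = gm S y w v.
Proof. exact: metric_sym. Qed.

(** Metric compatibility passes to the pull-back, by expansion in coordinate
    fields of the ambient manifold. *)
Lemma is_mdiff_gm Z W p : adiff i Z p -> adiff i W p ->
  is_mdiff (fun q => gm S (i q) (Z q) (W q)) p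
    (fun v => gm S (i p) (Di Z p v) (W p) + gm S (i p) (Z p) (Di W p v)).
Proof.
move=> dZ dW; set c := ichart p; have cp : cdom c (i p) := cdom_chart_at (i p).
pose dz j v : R := mderiv (acomp i c Z) p v 0 j.
pose dw j v : R := mderiv (acomp i c W) p v 0 j.
have dzP j : is_mdiff (fun q => acomp i c Z q 0 j) p (dz j) := is_diff_coord 0 j dZ.
have dwP j : is_mdiff (fun q => acomp i c W q 0 j) p (dw j) := is_diff_coord 0 j dW.
have Cs j : vsmooth_at (coord_field c j) (i p) by exact: coord_field_smooth.
pose g j l (y : N) := gm S y (coord_field c j y) (coord_field c l y).
have gs j l : msmooth_at (g j l) (i p) by exact: (metric_smooth S_metric).
have dgP j l : is_mdiff (g j l \o i) p
   (fun v => mderiv (g j l) (i p) (tmap i p v)).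
  exact: (is_mdiff_immersion M_sub (msmooth_mdiff (gs j l))).
have dgE j l v : mderiv (g j l) (i p) v
    = gm S (i p) (D (coord_field c j) (i p) v) (coord_field c l (i p))
    + gm S (i p) (coord_field c j (i p)) (D (coord_field c l) (i p) v).
  exact: (lc_metric D_lc).
have E : {near p, (fun q => \sum_j \sum_l
     (acomp i c Z q 0 j * acomp i c W q 0 l) * (g j l \o i) q)
   =1 fun q => gm S (i q) (Z q) (W q)}.
  apply: filterS (near_immersion_cdom M_sub cp) => q cq.
  rewrite [in RHS](tcoord_expand (Z q) cq) gm_suml; apply: eq_bigr => j _.
  rewrite [in RHS](tcoord_expand (W q) cq) gm_sumr; apply: eq_bigr => l _.
  by rewrite gmZl gmZr mulrA.
apply: near_eq_is_mdiff E _.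
apply: is_diff_eq (is_mdiff_sum (index_enum 'I_d) (fun j => is_mdiff_sum (index_enum 'I_d)
  (fun l => is_mdiffM (is_mdiffM (dzP j) (dwP l)) (dgP j l)))) _.
apply/funext => v.
have [_ ->] := pullback_expand M_sub Dc v cp dzP.
have [_ ->] := pullback_expand M_sub Dc v cp dwP.
rewrite (tcoord_expand (W p) cp) (tcoord_expand (Z p) cp) !gm_suml -big_split.
apply: eq_bigr => j _; rewrite !gm_sumr -big_split; apply: eq_bigr => l _.
rewrite /= dgE !gmZl !gmDl !gmDr !gmZl !gmZr -!/(acomp i c _ _) /g /=.
ring.
Qed.

End PullbackMetric.

Section Semisymmetric.
Variables (R : realType) (d k : nat) (N : manifold R d) (M : manifold R k).
Variables (i : M -> N) (M_sub : immersion i).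
Variables (S : acm_structure N) (D : cov_op N) (f1 f2 f3 : N -> R).
Hypothesis N_gssf : gen_sasakian_space_form S f1 f2 f3 D.
Hypothesis N_std : standing_identities S f1 f3 D.
Implicit Types (p q : M) (Z W : M -> 'rV[R]_d) (X Y : M -> 'rV[R]_k).

Let acm := gssf_acm N_gssf.
Let lc := gssf_lc N_gssf.
Let Dc := lc_connection lc.
Let S_metric := acm_metric acm.
Local Notation Di := (pullback_cov i D).
Local Notation Ds := (pullback_cov i (semisym_metric_conn S D)).
Local Notation ichart p := (chart_at (i p)).

Lemma pullback_semisymE Z p v : Ds Z p v = Di Z p v
  + eta S (i p) (Z p) *: tmap i p v - gm S (i p) (tmap i p v) (Z p) *: xi S (i p).
Proof.
rewrite !pullback_covE -!addrA; congr (_ + _).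
have -> : eta S (i p) (Z p) = \sum_j Z p 0 j * eta S (i p) (delta_mx 0 j).
  exact: (linear_row_expand (F := eta S (i p) : _ -> R^o) _ (eta_lin S (i p))).
have -> : gm S (i p) (tmap i p v) (Z p)
    = \sum_j Z p 0 j * gm S (i p) (tmap i p v) (delta_mx 0 j).
  rewrite {1}(row_sum_delta (Z p)) gm_sumr.
  by apply: eq_bigr => j _; rewrite gmZr.
rewrite !scaler_suml -sumrB -big_split; apply: eq_bigr => j _ /=.
rewrite /semisym_metric_conn coord_field_chart_at.
by rewrite !scalerDr scalerN !scalerA addrA.
Qed.

Lemma gm_xi (y : N) v : gm S y v (xi S y) = eta S y v.
Proof. exact: acm_g_xi. Qed.

Lemma etaD (y : N) u v : eta S y (u + v) = eta S y u + eta S y v.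
Proof. by rewrite -!gm_xi gmDl. Qed.
Lemma etaZ (y : N) a u : eta S y (a *: u) = a * eta S y u.
Proof. by rewrite -!gm_xi gmZl. Qed.
Lemma etaN (y : N) u : eta S y (- u) = - eta S y u.
Proof. by rewrite -!gm_xi gmNl. Qed.

Lemma adiff_xi p : adiff i (xi S \o i) p.
Proof. by apply: (adiff_comp M_sub); exact: acm_xi_smooth. Qed.

Lemma pullback_xi p v : Di (xi S \o i) p v = D (xi S) (i p) (tmap i p v).
Proof. by apply: (pullback_comp M_sub Dc); exact: acm_xi_smooth. Qed.

Lemma is_mdiff_eta Z p : adiff i Z p ->
  is_mdiff (fun q => eta S (i q) (Z q)) p (fun v => eta S (i p) (Di Z p v)
    + gm S (i p) (Z p) (D (xi S) (i p) (tmap i p v))).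
Proof.
move=> dZ; rewrite (_ : (fun q => _) = fun q => gm S (i q) (Z q) ((xi S \o i) q)).
  apply: is_diff_eq (is_mdiff_gm M_sub lc S_metric dZ (adiff_xi p)) _.
  by apply/funext => v; rewrite pullback_xi /= gm_xi.
by apply/funext => q; rewrite /= gm_xi.
Qed.

(** The terms by which the semisymmetric connection differs from [D] are
    skew-symmetric with respect to [g], hence it is metric as well. *)
Lemma is_mdiff_gm_semisym Z W p : adiff i Z p -> adiff i W p ->
  is_mdiff (fun q => gm S (i q) (Z q) (W q)) p
    (fun v => gm S (i p) (Ds Z p v) (W p) + gm S (i p) (Z p) (Ds W p v)).
Proof.
move=> dZ dW; apply: is_diff_eq (is_mdiff_gm M_sub lc S_metric dZ dW) _.
apply/funext => v; rewrite !pullback_semisymE.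
rewrite !gmDl !gmDr !gmNl !gmNr !gmZl !gmZr.
rewrite (gmC S_metric _ (xi S (i p)) (W p)) !gm_xi.
rewrite (gmC S_metric _ (Z p) (tmap i p v)).
ring.
Qed.

(** Besides the bracket, the torsion only involves [X] and [Y]; it is tangent to
    the submanifold. *)
Lemma semisym_torsion X Y p : vsmooth_at X p -> vsmooth_at Y p ->
  Ds (tfield i Y) p (X p) - Ds (tfield i X) p (Y p)
  = tmap i p (lie_bracket X Y p + etaM i S p (Y p) *: X p
              - etaM i S p (X p) *: Y p).
Proof.
move=> Xs Ys; have := pullback_torsion M_sub Dc (lc_torsion_free lc) Xs Ys.
move: (lie_bracket X Y p) => b T.
rewrite !pullback_semisymE !tmapD tmapN !tmapZ -T.
rewrite /tfield (gmC S_metric _ (tmap i p (Y p))) /etaM.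
by apply/rowP => l; rewrite !mxE; ring.
Qed.

(** The curvature is prescribed on smooth fields of the ambient manifold; by
    trilinearity the values on coordinate fields determine it on vectors. *)
Lemma pullback_curvature_gssf X Y Z p :
  vsmooth_at X p -> vsmooth_at Y p -> msmooth_at (acomp i (ichart p) Z) p ->
  Di (fun q => Di Z q (Y q)) p (X p) - Di (fun q => Di Z q (X q)) p (Y p)
    - Di Z p (lie_bracket X Y p)
  = gssf_tensor S f1 f2 f3 (i p) (tmap i p (X p)) (tmap i p (Y p)) (Z p).
Proof.
move=> Xs Ys Zs; rewrite (pullback_curvature M_sub Dc Xs Ys Zs).
have Cs j : vsmooth_at (coord_field (ichart p) j) (i p).
  by apply: coord_field_smooth; exact: cdom_chart_at.
set K := gssf_tensor S f1 f2 f3 (i p).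
rewrite [RHS](linear_row_expand (F := K (tmap i p (X p)) (tmap i p (Y p))));
  last by move=> *; exact: gssf_tensor_lin3.
apply: eq_bigr => j _.
rewrite [in RHS](linear_row_expand (F := fun x => K x _ _));
  last by move=> *; exact: gssf_tensor_lin1.
rewrite scaler_sumr; apply: eq_bigr => a _.
rewrite [in RHS](linear_row_expand (F := fun y => K _ y _));
  last by move=> *; exact: gssf_tensor_lin2.
rewrite !scaler_sumr; apply: eq_bigr => b _.
by rewrite (gssf_curvature N_gssf)// !coord_field_chart_at !scalerA.
Qed.

(** The curvature tensor of the semisymmetric connection, as computed in
    [semisym_curvature]. *)
Definition semisym_tensor (y : N) (x1 x2 z : 'rV[R]_d) : 'rV[R]_d :=
  gssf_tensor S f1 f2 f3 y x1 x2 z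
  + (gm S y z (D (xi S) y x1) - eta S y z * eta S y x1 + gm S y x1 z) *: x2
  - (gm S y z (D (xi S) y x2) - eta S y z * eta S y x2 + gm S y x2 z) *: x1
  + (gm S y x2 z * eta S y x1 - gm S y x1 z * eta S y x2) *: xi S y
  - gm S y x2 z *: D (xi S) y x1 + gm S y x1 z *: D (xi S) y x2.

(** One differentiation of the three terms of [pullback_semisymE], with the
    Levi-Civita connection. *)
Lemma semisym_second Y Z p : vsmooth_at Y p -> adiff i Z p ->
  adiff i (fun q => Di Z q (Y q)) p ->
  adiff i (fun q => Ds Z q (Y q)) p /\
  forall v, Di (fun q => Ds Z q (Y q)) p v = Di (fun q => Di Z q (Y q)) p v
    + ((eta S (i p) (Di Z p v) + gm S (i p) (Z p) (D (xi S) (i p) (tmap i p v)))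
         *: tmap i p (Y p) + eta S (i p) (Z p) *: Di (tfield i Y) p v)
    - ((gm S (i p) (Di (tfield i Y) p v) (Z p)
        + gm S (i p) (tmap i p (Y p)) (Di Z p v)) *: xi S (i p)
       + gm S (i p) (tmap i p (Y p)) (Z p) *: D (xi S) (i p) (tmap i p v)).
Proof.
move=> Ys dZ dDZ; have dY := adiff_tfield M_sub Dc Ys.
have de := is_mdiff_eta dZ; have dg := is_mdiff_gm M_sub lc S_metric dY dZ.
have d1 := adiffZ (is_mdiff_mdiff de) dY.
have d2 := adiffZ (is_mdiff_mdiff dg) (adiff_xi p).
have d3 := adiffZ (is_mdiff_mdiff (is_mdiff_cst (-1 : R) p)) d2.
have E : (fun q => Ds Z q (Y q)) = fun q => (Di Z q (Y q)
    + eta S (i q) (Z q) *: tfield i Y q)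
    + (-1) *: (gm S (i q) (tfield i Y q) (Z q) *: (xi S \o i) q).
  by apply/funext => q; rewrite pullback_semisymE scaleN1r.
rewrite E; split=> [|v]; first exact: (adiffD (adiffD dDZ d1) d3).
rewrite (pullbackD D v (adiffD dDZ d1) d3) (pullbackD D v dDZ d1).
rewrite (pullback_leibniz D v de dY).
rewrite (pullback_leibniz D v (is_mdiff_cst (-1 : R) p) d2).
rewrite (pullback_leibniz D v dg (adiff_xi p)) pullback_xi.
by rewrite scale0r add0r scaleN1r.
Qed.

(** The derivatives of [Z] cancel, except for its curvature for [D]; those of
    [X] and [Y] enter through their bracket only. *)
Lemma semisym_curvature X Y Z p :
  vsmooth_at X p -> vsmooth_at Y p -> msmooth_at (acomp i (ichart p) Z) p ->
  Ds (fun q => Ds Z q (Y q)) p (X p) - Ds (fun q => Ds Z q (X q)) p (Y p)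
    - Ds Z p (lie_bracket X Y p)
  = semisym_tensor (i p) (tmap i p (X p)) (tmap i p (Y p)) (Z p).
Proof.
move=> Xs Ys Zs; have dZ : adiff i Z p := msmooth_mdiff Zs.
have [dXZ _] := pullback_pullback M_sub Dc Zs Xs.
have [dYZ _] := pullback_pullback M_sub Dc Zs Ys.
rewrite (pullback_semisymE (fun q => _)) [X in _ - X - _](pullback_semisymE (fun q => _)).
rewrite !(pullback_semisymE Z).
have [_ ->] := semisym_second Ys dZ dYZ; have [_ ->] := semisym_second Xs dZ dXZ.
(* The derivatives become variables: bilinearity then applies to them as
   wholes instead of looking inside their definitions. *)
have := pullback_torsion M_sub Dc (lc_torsion_free lc) Xs Ys.
have := pullback_curvature_gssf Xs Ys Zs.
rewrite /semisym_tensor; move: (lie_bracket X Y p) => b <- <-.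
move: (Di (fun q => Di Z q (Y q)) p (X p)) (Di (fun q => Di Z q (X q)) p (Y p))
  (Di Z p b) (Di Z p (X p)) (Di Z p (Y p)) (Di (tfield i Y) p (X p))
  (Di (tfield i X) p (Y p)) => DXYZ DYXZ DbZ DXZ DYZ DXY DYX.
rewrite ?gmDl ?gmDr ?gmNl ?gmNr ?gmZl ?gmZr ?etaD ?etaN ?etaZ ?gm_xi (acm_eta_xi acm).
rewrite (gmC S_metric _ (tmap i p (Y p)) (tmap i p (X p))).
rewrite ?(gmC S_metric _ (Z p)).
by apply/rowP => l; rewrite !mxE; ring.
Qed.

End Semisymmetric.

(** * Tangential parts and orthonormal frames *)

Lemma rows_gram_entry (R : comPzRingType) r k (e : 'I_r -> 'rV[R]_k)
    (A : 'M[R]_k) a b :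
  ((\matrix_(a < r) e a) *m (A *m (\matrix_(a < r) e a)^T)) a b
  = (e a *m A *m (e b)^T) 0 0.
Proof.
rewrite -mulmxA [LHS]mxE [RHS]mxE; apply: eq_bigr => j _; congr (_ * _).
  by rewrite mxE.
by rewrite [LHS]mxE [RHS]mxE; apply: eq_bigr => l _; rewrite !mxE.
Qed.

Section TangentialPart.
Variables (R : realType) (d k : nat) (N : manifold R d) (M : manifold R k).
Variables (i : M -> N) (S : acm_structure N).
Hypothesis S_metric : riemannian_metric (acm_g S).
Hypothesis tmap_inj : forall p, injective (tmap i p).
Implicit Types (p q : M).

Lemma gM_tmap p v w : gM i S p v w = gm S (i p) (tmap i p v) (tmap i p w).
Proof.
by rewrite /gM /gm /pairing /induced_metric /tmap trmx_mul !mulmxA.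
Qed.

Lemma gm_eq0 (y : N) v : gm S y v v = 0 -> v = 0.
Proof.
move=> v0; apply/eqP; case: (eqVneq v 0) => // /(metric_pos S_metric y).
by rewrite -/(gm S y v v) v0 ltxx.
Qed.

Lemma induced_metric_unit p : induced_metric i S p \in unitmx.
Proof.
rewrite -row_free_unit -kermx_eq0; apply/rowV0P => v /sub_kermxP vG.
apply: (@tmap_inj p); rewrite [RHS]mul0mx; apply: (@gm_eq0 (i p)).
by rewrite -gM_tmap /gM /pairing vG mul0mx mxE.
Qed.

(** The defining property of the orthogonal projection; it needs the Gram
    matrix of the tangent space to be invertible ([induced_metric_unit]). *)
Lemma gm_tan_part p w v :
  gm S (i p) (tmap i p (tan_part i S p w)) (tmap i p v) = gm S (i p) w (tmap i p v).
Proof.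
rewrite /gm /pairing /tmap /tan_part /orth_coord trmx_mul.
have G := induced_metric_unit p; rewrite /induced_metric in G.
set B := tangent_mx i p; rewrite -/B in G; set g := acm_g S (i p).
rewrite -/g in G.
have -> : w *m (g *m B^T *m invmx (B *m g *m B^T)) *m B *m g *m (B^T *m v^T)
   = w *m (g *m B^T *m (invmx (B *m g *m B^T) *m (B *m g *m B^T))) *m v^T.
  by rewrite !mulmxA.
by rewrite mulVmx// mulmx1 !mulmxA.
Qed.

Lemma tan_part_tmap p v : tan_part i S p (tmap i p v) = v.
Proof.
rewrite /tan_part /tmap /orth_coord !mulmxA -!(mulmxA v).
by rewrite mulmxV ?mulmx1//; exact: induced_metric_unit.
Qed.

Lemma orthonormal_mxE p (e : 'I_k -> 'rV[R]_k) :
  (forall a b, gM i S p (e a) (e b) = (a == b)%:R) ->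
  let E := \matrix_(a < k) e a in
  induced_metric i S p *m E^T *m E = 1%:M.
Proof.
move=> eo E; apply: mulmx1C; apply/matrixP => a b.
by rewrite rows_gram_entry [RHS]mxE -eo.
Qed.

Lemma orthonormal_expand p (e : 'I_k -> 'rV[R]_k) v :
  (forall a b, gM i S p (e a) (e b) = (a == b)%:R) ->
  v = \sum_a gM i S p v (e a) *: e a.
Proof.
move=> /orthonormal_mxE /=; set Em := \matrix_(a < k) e a => EE.
have vE : v = v *m induced_metric i S p *m Em^T *m Em.
  by rewrite -[LHS]mulmx1 -EE !mulmxA.
rewrite {1}vE mulmx_sum_row.
apply: eq_bigr => a _; rewrite rowK; congr (_ *: _).
rewrite /gM /pairing [LHS]mxE [RHS]mxE; apply: eq_bigr => j _.
by congr (_ * _); rewrite !mxE.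
Qed.

End TangentialPart.

(** * The Gauss equation *)

Section Gauss.
Variables (R : realType) (d k : nat) (N : manifold R d) (M : manifold R k).
Variables (i : M -> N) (M_sub : immersion i).
Variables (S : acm_structure N) (D : cov_op N) (f1 f2 f3 : N -> R).
Hypothesis N_gssf : gen_sasakian_space_form S f1 f2 f3 D.
Hypothesis N_std : standing_identities S f1 f3 D.
Variables (p : M) (E : 'I_k -> M -> 'rV[R]_k).
Hypothesis Es : forall a, vsmooth_at (E a) p.
Hypothesis Eo : \forall q \near p, forall a b, gM i S q (E a q) (E b q) = (a == b)%:R.
Implicit Types (X Y Z W : M -> 'rV[R]_k).

Let lc := gssf_lc N_gssf.
Let Dc := lc_connection lc.
Let S_metric := acm_metric (gssf_acm N_gssf).
Let iI := imm_injective M_sub.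
Local Notation sD := (semisym_metric_conn S D).
Local Notation Ds := (pullback_cov i sD).
Local Notation h := (second_ff i S sD).
Local Notation g := (gm S (i p)).

(** [tan_part] is defined through the inverse of a Gram matrix; the frame gives
    an expression whose differentiability is visible. *)
Lemma near_tan_part (W : M -> 'rV[R]_d) : {near p, (fun q => \sum_a
    gm S (i q) (W q) (tfield i (E a) q) *: tfield i (E a) q)
  =1 fun q => tmap i q (tan_part i S q (W q))}.
Proof.
apply: filterS Eo => q Eq.
rewrite [in RHS](orthonormal_expand (tan_part i S q (W q)) Eq).
rewrite /tmap mulmx_suml; apply: eq_bigr => a _; rewrite -scalemxAl.
by rewrite gM_tmap gm_tan_part.
Qed.

Lemma adiff_tan_part (W : M -> 'rV[R]_d) : adiff i W p ->
  adiff i (fun q => tmap i q (tan_part i S q (W q))) p.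
Proof.
move=> dW; have dE a := adiff_tfield M_sub Dc (Es a).
apply: near_eq_adiff (near_tan_part W) _; apply: adiff_sum => a.
apply: adiffZ (dE a).
exact: is_mdiff_mdiff (is_mdiff_gm M_sub lc S_metric dW (dE a)).
Qed.

Lemma second_ff_normal Y q v w : gm S (i q) (h Y q v) (tmap i q w) = 0.
Proof.
by rewrite /second_ff /induced_conn gmDl gmNl gm_tan_part// subrr.
Qed.

(** Weingarten relation: differentiate [g (h Z Y) W = 0] and use that the
    connection is metric. *)
Lemma gm_second_ff_deriv Y Z W v : vsmooth_at W p -> adiff i (fun q => h Z q (Y q)) p ->
  g (Ds (fun q => h Z q (Y q)) p v) (tmap i p (W p)) = - g (h Z p (Y p)) (h W p v).
Proof.
move=> Ws dh; have dW := adiff_tfield M_sub Dc Ws.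
have H := is_mdiff_gm_semisym M_sub N_gssf dh dW.
have H0 : is_mdiff (fun q => gm S (i q) (h Z q (Y q)) (tfield i W q)) p (fun=> 0).
  rewrite (_ : (fun q => _) = fun=> 0); first exact: is_mdiff_cst.
  by apply/funext => q; rewrite second_ff_normal.
have := is_diff_fun_uniq H H0 => /(congr1 (@^~ v)) /eqP.
rewrite addr_eq0 => /eqP ->; congr (- _).
rewrite /second_ff -/(h Z p (Y p)) [in RHS]gmDr gmNr second_ff_normal.
by rewrite oppr0 addr0.
Qed.

Lemma adiff_semisym Y Z : vsmooth_at Y p -> vsmooth_at Z p ->
  adiff i (fun q => Ds (tfield i Z) q (Y q)) p.
Proof.
move=> Ys Zs; have Zt := msmooth_acomp_tfield M_sub Zs.
have dZ : adiff i (tfield i Z) p := msmooth_mdiff Zt.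
have [dYZ _] := pullback_pullback M_sub Dc Zt Ys.
by have [] := semisym_second M_sub N_gssf Ys dZ dYZ.
Qed.

(** Differentiate the tangential part as the difference of the full derivative
    and its normal part; the latter contributes by [gm_second_ff_deriv]. *)
Lemma induced_second X Y Z W :
  vsmooth_at X p -> vsmooth_at Y p -> vsmooth_at Z p -> vsmooth_at W p ->
  gM i S p (induced_conn i S sD (fun q => induced_conn i S sD Z q (Y q)) p (X p)) (W p)
  = g (Ds (fun q => Ds (tfield i Z) q (Y q)) p (X p)) (tmap i p (W p))
    + g (h Z p (Y p)) (h W p (X p)).
Proof.
move=> Xs Ys Zs Ws; have dDs := adiff_semisym Ys Zs.
have dT := adiff_tan_part dDs.
have hE : (fun q => h Z q (Y q)) = fun q => Ds (tfield i Z) q (Y q)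
    + (-1) *: tmap i q (tan_part i S q (Ds (tfield i Z) q (Y q))).
  by apply/funext => q; rewrite scaleN1r.
have dNT := adiffZ (is_mdiff_mdiff (is_mdiff_cst (-1 : R) p)) dT.
have dh : adiff i (fun q => h Z q (Y q)) p by rewrite hE; exact: (adiffD dDs dNT).
have := gm_second_ff_deriv (X p) Ws dh.
rewrite {1}hE (pullbackD _ _ dDs dNT).
rewrite (pullback_leibniz _ _ (is_mdiff_cst (-1 : R) p) dT) scale0r add0r.
rewrite gmDl gmZl mulN1r => /eqP; rewrite subr_eq => /eqP ->.
by rewrite gM_tmap /induced_conn gm_tan_part// addrAC addNr add0r.
Qed.

Lemma gauss_equation X Y Z W :
  vsmooth_at X p -> vsmooth_at Y p -> vsmooth_at Z p -> vsmooth_at W p ->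
  gM i S p (curvature (induced_conn i S sD) X Y Z p) (W p)
  = g (semisym_tensor S D f1 f2 f3 (i p) (tmap i p (X p)) (tmap i p (Y p)) (tmap i p (Z p)))
      (tmap i p (W p))
    + g (h Z p (Y p)) (h W p (X p)) - g (h Z p (X p)) (h W p (Y p)).
Proof.
move=> Xs Ys Zs Ws; have Zt := msmooth_acomp_tfield M_sub Zs.
rewrite -(semisym_curvature M_sub N_gssf Xs Ys Zt).
rewrite /curvature.
have gMB u v w : gM i S p (u - v) w = gM i S p u w - gM i S p v w.
  by rewrite !gM_tmap tmapD tmapN gmDl gmNl.
rewrite gMB gMB [X in X - _ - _ = _](induced_second Xs Ys Zs Ws).
rewrite [X in _ - X - _ = _](induced_second Ys Xs Zs Ws).
rewrite [gM i S p (induced_conn _ _ _ Z p _) _]gM_tmap /induced_conn gm_tan_part//.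
move: (Ds (fun q => Ds (tfield i Z) q (Y q)) p (X p))
  (Ds (fun q => Ds (tfield i Z) q (X q)) p (Y p))
  (Ds (tfield i Z) p (lie_bracket X Y p)) (h Z p (Y p)) (h W p (X p))
  (h Z p (X p)) (h W p (Y p)) => u v w hZY hWX hZX hWY.
rewrite !gmDl !gmNl; ring.
Qed.

(** The difference is tangent, because the torsion is, and normal, because each
    term is. *)
Lemma second_ff_sym X Y : vsmooth_at X p -> vsmooth_at Y p ->
  h Y p (X p) = h X p (Y p).
Proof.
move=> Xs Ys; apply/eqP; rewrite -subr_eq0; apply/eqP.
have [u hu] : exists u, h Y p (X p) - h X p (Y p) = tmap i p u.
  rewrite /second_ff.
  have -> : forall a b a' b' : 'rV[R]_d, a - b - (a' - b') = (a - a') - (b - b').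
    by move=> a b a' b'; apply/rowP => l; rewrite !mxE; ring.
  rewrite (semisym_torsion M_sub N_gssf Xs Ys).
  set u := _ - _ *: Y p; move: (induced_conn _ _ _ _ _ _) => v.
  move: (induced_conn _ _ _ _ _ _) => w.
  by exists (u - (v - w)); rewrite !(tmapD, tmapN).
rewrite hu; apply: (gm_eq0 S_metric (y := i p)).
rewrite -{1}hu.
have gB a b c : g (a - b) c = g a c - g b c by rewrite gmDl gmNl.
rewrite (gB (h Y p (X p))); apply/eqP; rewrite subr_eq0; apply/eqP.
exact: (etrans (second_ff_normal Y p (X p) u) (esym (second_ff_normal X p (Y p) u))).
Qed.

End Gauss.

(** * Orthogonal projections *)

Section OrthogonalProjection.
Variables (R : realType) (k : nat) (H : 'M[R]_k).
Hypothesis H_pos : forall v : 'rV[R]_k, v != 0 -> 0 < (v *m H *m v^T) 0 0.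

Lemma gram_unit r (B : 'M[R]_(r, k)) : row_free B -> B *m H *m B^T \in unitmx.
Proof.
move=> Bf; rewrite -row_free_unit -kermx_eq0; apply/rowV0P => v /sub_kermxP vB.
have vB0 : v *m B = 0.
  apply/eqP; case: (eqVneq (v *m B) 0) => // /H_pos.
  have -> : v *m B *m H *m (v *m B)^T = v *m (B *m H *m B^T) *m v^T.
    by rewrite trmx_mul !mulmxA.
  by rewrite vB mul0mx mxE ltxx.
by apply: (row_free_inj Bf); rewrite vB0 mul0mx.
Qed.

Variables (r : nat) (A : 'M[R]_(r, k)).
Local Notation P := (orth_projection H A).
Local Notation B := (row_base A).

Let BU : B *m H *m B^T \in unitmx.
Proof. by apply: gram_unit; exact: row_base_free. Qed.

Lemma orth_projection_sub (v : 'rV[R]_k) : (v *m P <= A)%MS.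
Proof. by rewrite /orth_projection mulmxA -(eq_row_base A) submxMl. Qed.

Lemma orth_projection_id (v : 'rV[R]_k) : (v <= A)%MS -> v *m P = v.
Proof.
rewrite -(eq_row_base A) => /submxP[c ->].
rewrite /orth_projection /orth_coord.
have -> : c *m B *m (H *m B^T *m invmx (B *m H *m B^T) *m B)
  = c *m ((B *m H *m B^T) *m invmx (B *m H *m B^T)) *m B by rewrite !mulmxA.
by rewrite mulmxV// mulmx1.
Qed.

Lemma orth_projection_eq0 (v : 'rV[R]_k) :
  (forall u : 'rV[R]_k, (u <= A)%MS -> (v *m H *m u^T) 0 0 = 0) -> v *m P = 0.
Proof.
move=> vA; rewrite /orth_projection /orth_coord !mulmxA.
suff -> : v *m H *m B^T = 0 by rewrite !mul0mx.
apply/rowP => j; rewrite [RHS]mxE -[RHS](vA (row j B)).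
  rewrite [LHS]mxE [RHS]mxE; apply: eq_bigr => l _; congr (_ * _).
  by rewrite !mxE.
by rewrite -(eq_row_base A) row_sub.
Qed.

Lemma mxtrace_orth_projection : \tr P = (\rank A)%:R.
Proof.
rewrite /orth_projection /orth_coord mxtrace_mulC !mulmxA mulmxV//.
by rewrite mxtrace1.
Qed.

End OrthogonalProjection.

(** * The eigendistributions of an almost semi-invariant submanifold *)

Section AlmostSemiInvariant.
Variables (R : realType) (d k l : nat) (N : manifold R d) (M : manifold R k).
Variables (i : M -> N) (S : acm_structure N) (lam : 'I_l -> M -> R).
Hypothesis acm : almost_contact_metric S.
Hypothesis tmap_inj : forall p, injective (tmap i p).
Hypothesis M_asi : almost_semi_invariant i S lam.
Variable p : M.
Implicit Types (u v w : 'rV[R]_k) (a b : bool + 'I_l).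

Local Notation g := (gM i S p).
Local Notation T := (T_mx i S p).
Local Notation U := (U_proj i S lam).
Local Notation lab a := (label_val lam a p).
Let S_metric := acm_metric acm.

Lemma gM_sym v w : g v w = g w v.
Proof. by rewrite !gM_tmap; exact: metric_sym. Qed.
Lemma gM_Dl u v w : g (u + v) w = g u w + g v w.
Proof. by rewrite !gM_tmap tmapD gmDl. Qed.
Lemma gM_Zl (c : R) v w : g (c *: v) w = c * g v w.
Proof. by rewrite !gM_tmap tmapZ gmZl. Qed.
Lemma gM_Nl v w : g (- v) w = - g v w.
Proof. by rewrite !gM_tmap tmapN gmNl. Qed.
Lemma gM_suml (I : Type) (r : seq I) (Q : pred I) (u : I -> 'rV[R]_k) w :
  g (\sum_(a <- r | Q a) u a) w = \sum_(a <- r | Q a) g (u a) w.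
Proof.
elim: r => [|a r IHr]; last by rewrite !big_cons; case: ifP; rewrite ?gM_Dl IHr.
by rewrite !big_nil /gM /pairing !mul0mx mxE.
Qed.

Lemma gM_pos v : v != 0 -> 0 < g v v.
Proof.
move=> v0; rewrite gM_tmap; apply: (metric_pos S_metric).
apply: contraNneq v0 => tv0; apply/eqP; apply: (@tmap_inj p).
by rewrite tv0 /tmap mul0mx.
Qed.

Lemma mulT_tan_part v : v *m T = tan_part i S p (phi S (i p) (tmap i p v)).
Proof. by rewrite /T_mx /tan_part /phi /tmap !mulmxA. Qed.

Lemma gM_T v w : g (v *m T) w = gm S (i p) (phi S (i p) (tmap i p v)) (tmap i p w).
Proof. by rewrite gM_tmap mulT_tan_part gm_tan_part. Qed.

Lemma gM_T_skew v w : g (v *m T) w = - g v (w *m T).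
Proof.
by rewrite gM_T (acm_g_phi acm) [in RHS]gM_sym gM_T [X in _ = - X](gmC S_metric).
Qed.

Lemma gM_T_self v : g (v *m T) v = 0.
Proof. by have := gM_T_skew v v; rewrite [in RHS]gM_sym => H; lra. Qed.

Lemma tmap_xiM : tmap i p (xiM i S p) = xi S (i p).
Proof.
have [v vxi] := asi_xi M_asi p.
by rewrite /xiM -vxi tan_part_tmap.
Qed.

Lemma etaM_gM v : etaM i S p v = g v (xiM i S p).
Proof. by rewrite gM_tmap tmap_xiM /etaM -(acm_g_xi acm). Qed.

Lemma etaM_xiM : etaM i S p (xiM i S p) = 1.
Proof. by rewrite /etaM tmap_xiM (acm_eta_xi acm). Qed.

Lemma xiM_T : xiM i S p *m T = 0.
Proof.
by rewrite mulT_tan_part tmap_xiM (acm_phi_xi acm) /tan_part mul0mx.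
Qed.

Lemma dist_eta a v : (v <= dist i S lam a p)%MS -> etaM i S p v = 0.
Proof.
rewrite /dist /eigen_dist sub_capmx => /andP[/sub_kermxP vxi _].
by rewrite etaM_gM /gM /pairing -mulmxA vxi mxE.
Qed.

Lemma dist_TT a v : (v <= dist i S lam a p)%MS ->
  v *m T *m T = (- lab a ^+ 2) *: v.
Proof.
rewrite /dist /eigen_dist sub_capmx => /andP[_ /eigenspaceP <-].
by rewrite -mulmxA.
Qed.

Lemma label_sqr_inj a b : a != b -> lab a ^+ 2 != lab b ^+ 2.
Proof.
have inr_neq (c : bool) j : (c%:R : R) ^+ 2 != lam j p ^+ 2.
  have /andP[l0 l1] := asi_range M_asi j p.
  case: c => /=; rewrite ?expr1n ?expr0n/=; first by rewrite gt_eqF// expr_lt1// ltW.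
  by rewrite lt_eqF// exprn_gt0.
case: a b => [c|j] [c'|j'] ab /=.
- have cc' : c != c' by apply: contra_neq ab => ->.
  by case: c c' cc' {ab} => [] [] //= _; rewrite expr1n expr0n /= ?oner_eq0// eq_sym oner_eq0.
- exact: inr_neq.
- by rewrite eq_sym; exact: inr_neq.
- apply: contra_neq ab => E; have -> // : j = j'.
  by apply: (asi_distinct M_asi (p := p)); rewrite /= E.
Qed.

(** Eigenvectors of the self-adjoint operator [T ^+ 2] for distinct
    eigenvalues. *)
Lemma dist_orthogonal a b u v : a != b -> (u <= dist i S lam a p)%MS ->
  (v <= dist i S lam b p)%MS -> g u v = 0.
Proof.
move=> /label_sqr_inj ab ua vb.
have H : g (u *m T *m T) v = g (v *m T *m T) u.
  by rewrite gM_T_skew (gM_T_skew u) opprK gM_sym.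
move: H; rewrite (dist_TT ua) (dist_TT vb) !gM_Zl (gM_sym v u) => /eqP.
rewrite -subr_eq0 -mulrBl mulf_eq0 => /orP[|/eqP//].
by rewrite opprK addrC subr_eq0 eq_sym (negbTE ab).
Qed.

Lemma U_dist a v : (U a p v <= dist i S lam a p)%MS.
Proof. exact: orth_projection_sub. Qed.

(** The direct sum of the hypothesis is orthogonal by [dist_orthogonal] and
    [dist_eta], so its components are the orthogonal projections. *)
Lemma U_decomposition v :
  v = \sum_a U a p v + etaM i S p v *: xiM i S p.
Proof.
have [c [w [cw vE]]] : exists c (w : bool + 'I_l -> 'rV[R]_k),
    (forall a, (w a <= dist i S lam a p)%MS) /\ v = \sum_a w a + c *: xiM i S p.
  have : (v <= \sum_(a : bool + 'I_l) dist i S lam a p + xiM i S p)%MS.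
    by rewrite (eqmxP (asi_span M_asi p)) submx1.
  case/sub_addsmxP => -[x y] /= ->.
  have /sub_sumsmxP[z ->] : (x *m (\sum_(a : bool + 'I_l) dist i S lam a p)%MS
    <= \sum_(a : bool + 'I_l) dist i S lam a p)%MS by exact: submxMl.
  exists (y 0 0), (fun a => z a *m dist i S lam a p); split=> [a|].
    exact: submxMl.
  by rewrite {1}[y]mx11_scalar mul_scalar_mx.
have ceta : etaM i S p v = c.
  rewrite etaM_gM vE gM_Dl gM_suml gM_Zl -etaM_gM etaM_xiM mulr1 big1 ?add0r//.
  by move=> a _; rewrite -etaM_gM (dist_eta (cw a)).
rewrite ceta {1}vE; congr (_ + _); apply: eq_bigr => a _.
rewrite /U_proj -[LHS](orth_projection_id gM_pos (cw a)).
apply/eqP; rewrite -subr_eq0 -mulmxBl; apply/eqP.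
apply: orth_projection_eq0 => u ua; rewrite -[LHS]/(g _ u).
rewrite vE (bigD1 a)//= -addrA opprD addNKr gM_Nl gM_Dl gM_suml gM_Zl.
rewrite [X in _ * X]gM_sym -etaM_gM (dist_eta ua) mulr0 addr0 big1 ?oppr0//.
by move=> b ba; rewrite (dist_orthogonal ba (cw b) ua).
Qed.

Lemma gM_U a v : g (U a p v) v = g (U a p v) (U a p v).
Proof.
rewrite {2}(U_decomposition v) [LHS]gM_sym gM_Dl gM_suml gM_Zl.
rewrite [X in _ + _ * X]gM_sym -etaM_gM (dist_eta (U_dist a v)) mulr0 addr0.
rewrite (bigD1 a)//= big1 ?addr0// => b ba.
by rewrite (dist_orthogonal ba (U_dist b v) (U_dist a v)).
Qed.

Lemma gM_norm_decomposition v :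
  g v v = \sum_a g (U a p v) (U a p v) + etaM i S p v ^+ 2.
Proof.
rewrite {1}(U_decomposition v) gM_Dl gM_suml gM_Zl gM_sym -etaM_gM -expr2.
rewrite (eq_bigr (fun a => g (U a p v) (U a p v)))// => a _.
exact: gM_U.
Qed.

Lemma gM_TT v : g (v *m T) (v *m T)
  = \sum_a lab a ^+ 2 * g (U a p v) (U a p v).
Proof.
rewrite -[LHS]opprK -gM_T_skew {1}(U_decomposition v) !mulmxDl -!scalemxAl.
rewrite xiM_T mul0mx scaler0 addr0 !mulmx_suml gM_suml -sumrN.
apply: eq_bigr => a _; rewrite (dist_TT (U_dist a v)) gM_Zl gM_U.
by rewrite mulNr opprK.
Qed.

(** Both sides are minus the trace of [T ^+ 2]: a sum over an orthonormal basis
    on the left, a sum over eigenspaces on the right. *)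
Lemma sum_gM_TT (e : 'I_k -> 'rV[R]_k) :
  (forall j j', g (e j) (e j') = (j == j')%:R) ->
  \sum_j g (e j *m T) (e j *m T)
  = \sum_a (\rank (dist i S lam a p))%:R * lab a ^+ 2.
Proof.
move=> eo; under eq_bigr do rewrite gM_TT; rewrite exchange_big /=.
apply: eq_bigr => b _; rewrite -big_distrr /= mulrC; congr (_ * _).
under eq_bigr do rewrite -gM_U.
rewrite -(mxtrace_orth_projection gM_pos); set P := orth_projection _ _.
have EE := orthonormal_mxE eo; set Em := \matrix_(a < k) e a in EE.
have -> : P = (P *m induced_metric i S p *m Em^T) *m Em.
  by rewrite -[LHS]mulmx1 -EE !mulmxA.
rewrite mxtrace_mulC /mxtrace; apply: eq_bigr => j _.
by rewrite rows_gram_entry mulmxA.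
Qed.

End AlmostSemiInvariant.

(** * Ricci curvature of a minimal submanifold *)

Section Ricci.
Variables (R : realType) (d m l : nat) (N : manifold R d) (M : manifold R m.+1).
Variables (i : M -> N) (M_sub : immersion i).
Variables (S : acm_structure N) (D : cov_op N) (f1 f2 f3 : N -> R).
Hypothesis N_gssf : gen_sasakian_space_form S f1 f2 f3 D.
Hypothesis N_std : standing_identities S f1 f3 D.
Variables (lam : 'I_l -> M -> R) (M_asi : almost_semi_invariant i S lam).
Hypothesis M_min : minimal i S (semisym_metric_conn S D).
Variables (p : M) (E : 'I_m.+1 -> M -> 'rV[R]_m.+1).
Hypothesis E_frame : local_frame i S E p.

Let acm := gssf_acm N_gssf.
Let S_metric := acm_metric acm.
Let iI := imm_injective M_sub.
Local Notation sD := (semisym_metric_conn S D).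
Local Notation T := (T_mx i S p).
Local Notation g := (gM i S p).

(** The right-hand side is arranged by the products of [g(x,e)], [g(phi x,e)]
    and [eta(e)], whose sums over an orthonormal frame are given by [parseval];
    the terms in [g(x,e) g(phi x,e)] cancel. *)
Lemma gm_semisym_tensor (y : N) x e : gm S y e e = 1 ->
  gm S y (semisym_tensor S D f1 f2 f3 y x e e) x =
  (f1 y * gm S y x x - f3 y * eta S y x ^+ 2 - gm S y x x + eta S y x ^+ 2)
  + (1 - f1 y) * gm S y x e ^+ 2 + 3 * f2 y * gm S y (phi S y x) e ^+ 2
  + (gm S y x x - f3 y * gm S y x x) * eta S y e ^+ 2
  + (2 * f3 y - 2) * eta S y x * (gm S y x e * eta S y e).
Proof.
move=> e1.
have phi_self v : gm S y (phi S y v) v = 0.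
  have := acm_g_phi acm y v v; rewrite [in RHS](gmC S_metric).
  by move: (gm S y (phi S y v) v) => c cE; lra.
have xphi v : gm S y v (phi S y v) = 0 by rewrite (gmC S_metric).
have phi_skew : gm S y (phi S y e) x = - gm S y (phi S y x) e.
  by rewrite (acm_g_phi acm) (gmC S_metric).
have phi_skew' : gm S y x (phi S y e) = - gm S y (phi S y x) e.
  by rewrite (gmC S_metric).
rewrite /semisym_tensor /gssf_tensor !(nabla_xi N_std).
rewrite ?(gmDl, gmNl, gmZl, gmDr, gmNr, gmZr) !phi_self !xphi.
rewrite !(gmC S_metric y e x) !(gmC S_metric y (xi S y) x) !(gm_xi N_gssf) e1.
rewrite phi_skew phi_skew' (gmC S_metric y e (phi S y x)).
ring.
Qed.

Let Eo a b : g (E a p) (E b p) = (a == b)%:R.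
Proof. exact: (nbhs_singleton (frame_orthonormal E_frame)). Qed.

Lemma parseval v w : g v w = \sum_a g v (E a p) * g w (E a p).
Proof.
rewrite {1}(orthonormal_expand v Eo) gM_suml.
by apply: eq_bigr => a _; rewrite gM_Zl (gM_sym i acm p (E a p)).
Qed.

Lemma ambient_ricci (X : M -> 'rV[R]_m.+1) :
  \sum_a gm S (i p) (semisym_tensor S D f1 f2 f3 (i p) (tmap i p (X p))
      (tmap i p (E a p)) (tmap i p (E a p))) (tmap i p (X p))
  = m%:R * f1 (i p) * g (X p) (X p) + 3 * f2 (i p) * g (X p *m T) (X p *m T)
    - f3 (i p) * (g (X p) (X p) + (m%:R - 1) * etaM i S p (X p) ^+ 2)
    - (m%:R - 1) * g (X p) (X p) + (m%:R - 1) * etaM i S p (X p) ^+ 2.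
Proof.
have eta1 a : etaM i S p (E a p) = g (xiM i S p) (E a p).
  by rewrite (etaM_gM acm iI M_asi) (gM_sym i acm).
(* The part of [gm_semisym_tensor] that does not depend on [a], as a variable
   so that the sums below do not split it. *)
have [c0 c0E] : exists c0, c0 = f1 (i p) * g (X p) (X p)
    - f3 (i p) * etaM i S p (X p) ^+ 2 - g (X p) (X p) + etaM i S p (X p) ^+ 2.
  by eexists.
rewrite (eq_bigr (fun a => c0
  + (1 - f1 (i p)) * (g (X p) (E a p) * g (X p) (E a p))
  + 3 * f2 (i p) * (g (X p *m T) (E a p) * g (X p *m T) (E a p))
  + (g (X p) (X p) - f3 (i p) * g (X p) (X p))
    * (g (xiM i S p) (E a p) * g (xiM i S p) (E a p))
  + (2 * f3 (i p) - 2) * etaM i S p (X p)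
    * (g (X p) (E a p) * g (xiM i S p) (E a p)))); last first.
  move=> a _; rewrite gm_semisym_tensor; last by rewrite -gM_tmap Eo eqxx.
  rewrite c0E -eta1 (gM_T acm iI) [g (X p) (E a p)]gM_tmap [g (X p) (X p)]gM_tmap.
  by rewrite /etaM !expr2.
rewrite !big_split -!big_distrr -!parseval -!(etaM_gM acm iI M_asi).
rewrite (etaM_xiM acm iI M_asi) sumr_const card_ord /= -[c0 *+ _]mulr_natr -[m.+1%:R]natr1 c0E.
ring.
Qed.

(** In the Gauss equation summed over the frame, the terms
    [h(E_a,E_a)] add up to zero by minimality, and the others are the
    [- g(h(X,E_a), h(X,E_a))]. *)
Lemma ricci_le (X : M -> 'rV[R]_m.+1) : vsmooth_at X p ->
  ricci i S sD E X X p <=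
  m%:R * f1 (i p) * g (X p) (X p) + 3 * f2 (i p) * g (X p *m T) (X p *m T)
    - f3 (i p) * (g (X p) (X p) + (m%:R - 1) * etaM i S p (X p) ^+ 2)
    - (m%:R - 1) * g (X p) (X p) + (m%:R - 1) * etaM i S p (X p) ^+ 2.
Proof.
move=> Xs; have Es := frame_smooth E_frame.
have EO := frame_orthonormal E_frame.
rewrite -ambient_ricci /ricci /curvature4.
rewrite (eq_bigr _ (fun a _ => gauss_equation M_sub N_gssf Es EO Xs (Es a) (Es a) Xs)).
have h0 : \sum_a second_ff i S sD (E a) p (E a p) = 0.
  have /eqP := M_min E_frame; rewrite /mean_curvature scaler_eq0 => /orP[|/eqP//].
  by rewrite invr_eq0 pnatr_eq0.
have hX : \sum_a gm S (i p) (second_ff i S sD (E a) p (E a p))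
    (second_ff i S sD X p (X p)) = 0 by rewrite -gm_suml h0 gm0l.
rewrite !big_split /= hX addr0 gerDl sumrN oppr_le0 sumr_ge0// => a _.
rewrite (second_ff_sym M_sub N_gssf Xs (Es a)).
set w := second_ff _ _ _ _ _ _; have [->|w0] := eqVneq w 0; first by rewrite gm0l.
by rewrite ltW//; exact: (metric_pos S_metric).
Qed.

End Ricci.

Theorem theorem3p1 (R : realType) (n m l : nat)
  (N : manifold R n.*2.+1) (S : acm_structure N) (f1 f2 f3 : N -> R)
  (nabla : cov_op N)
  (M : manifold R m.+1) (i : M -> N) (lam : 'I_l -> M -> R)
  (n_gt1 : (1 < n)%N) (m_gt0 : (0 < m)%N)
  (N_gssf : gen_sasakian_space_form S f1 f2 f3 nabla)
  (N_std : standing_identities S f1 f3 nabla)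
  (M_sub : immersion i)
  (M_asi : almost_semi_invariant i S lam)
  (M_min : minimal i S (semisym_metric_conn S nabla)) :
  (forall X : M -> 'rV[R]_m.+1, (forall q, vsmooth_at X q) ->
   forall (p : M) (E : 'I_m.+1 -> M -> 'rV[R]_m.+1), local_frame i S E p ->
   ricci i S (semisym_metric_conn S nabla) E X X p <=
     \sum_(a : bool + 'I_l)
       (m%:R * f1 (i p) + 3 * f2 (i p) * label_val lam a p ^+ 2
        - f3 (i p) + 1)
       * gM i S p (U_proj i S lam a p (X p)) (U_proj i S lam a p (X p))
     + m%:R * (f1 (i p) - f3 (i p) + 1) * (etaM i S p (X p) * etaM i S p (X p))
     + (f1 (i p) - f3 (i p)) * (m%:R - 1)
       * gM i S p (X p *m T_mx i S p) (X p))
  /\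
  (forall (p : M) (E : 'I_m.+1 -> M -> 'rV[R]_m.+1), local_frame i S E p ->
   scalar_curvature i S (semisym_metric_conn S nabla) E p <=
     f1 (i p) + ((m * m.+1)%:R)^-1 *
       (3 * f2 (i p) *
          (\sum_(a : bool + 'I_l)
             (\rank (dist i S lam a p))%:R * label_val lam a p ^+ 2)
        - 2 * m%:R * (f3 (i p) - 1))).


Proof.
have acm := gssf_acm N_gssf; have iI := imm_injective M_sub.
split=> [X Xs p E Ef|p E Ef].
  apply: le_trans (ricci_le M_sub N_gssf N_std M_asi M_min Ef (Xs p)) _.
  rewrite (gM_T_self acm iI) (gM_TT acm iI M_asi) (gM_norm_decomposition acm iI M_asi).
  rewrite mulr0 addr0 -!expr2.
  set y2 := etaM i S p (X p) ^+ 2.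
  pose u a := gM i S p (U_proj i S lam a p (X p)) (U_proj i S lam a p (X p)).
  have u0 a : 0 <= u a.
    rewrite /u; have [->|v0] := eqVneq (U_proj i S lam a p (X p)) 0.
      by rewrite /gM /pairing !mul0mx mxE.
    exact/ltW/(gM_pos acm iI p v0).
  have -> : \sum_a (m%:R * f1 (i p) + 3 * f2 (i p) * label_val lam a p ^+ 2
      - f3 (i p) + 1) * gM i S p (U_proj i S lam a p (X p)) (U_proj i S lam a p (X p))
    = (m%:R * f1 (i p) - f3 (i p) + 1) * (\sum_a u a)
      + 3 * f2 (i p) * \sum_a label_val lam a p ^+ 2 * u a.
    rewrite !big_distrr -big_split; apply: eq_bigr => a _ /=; rewrite -/(u a); ring.
  have y20 : 0 <= y2 by exact: sqr_ge0.
  have s0 : 0 <= \sum_a u a by exact: sumr_ge0.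
  have m0 : (0 : R) <= m%:R by [].
  rewrite -!/(u _); set s := \sum_a u a in s0 *; set t := \sum_a _ * u a.
  (* The gap is [m * g (X p) (X p)]. *)
  rewrite -subr_ge0 [leRHS](_ : _ = m%:R * (s + y2)); last by ring.
  by rewrite mulr_ge0// addr_ge0.
have Eo a b : gM i S p (E a p) (E b p) = (a == b)%:R.
  exact: (nbhs_singleton (frame_orthonormal Ef)).
have mm0 : ((m * m.+1)%:R : R) != 0 by rewrite pnatr_eq0 -lt0n muln_gt0 m_gt0.
rewrite [leRHS](_ : _ = ((m * m.+1)%:R)^-1 * ((m * m.+1)%:R * f1 (i p)
  + (3 * f2 (i p) * (\sum_a (\rank (dist i S lam a p))%:R * label_val lam a p ^+ 2)
     - 2 * m%:R * (f3 (i p) - 1)))); last by rewrite [RHS]mulrDr mulKf.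
rewrite /scalar_curvature ler_wpM2l ?invr_ge0//.
have [c cE] : exists c, c = m%:R * f1 (i p) - f3 (i p) - (m%:R - 1) by eexists.
have bound a : ricci i S (semisym_metric_conn S nabla) E (E a) (E a) p <= c
    + 3 * f2 (i p) * gM i S p (E a p *m T_mx i S p) (E a p *m T_mx i S p)
    + (m%:R - 1) * (1 - f3 (i p)) * (gM i S p (xiM i S p) (E a p)
                                     * gM i S p (xiM i S p) (E a p)).
  apply: le_trans (ricci_le M_sub N_gssf N_std M_asi M_min Ef (frame_smooth Ef a)) _.
  rewrite Eo eqxx mulr1n (etaM_gM acm iI M_asi) (gM_sym i acm p (E a p)) cE.
  by rewrite le_eqVlt; apply/orP; left; apply/eqP; ring.
apply: le_trans (ler_sum _ (fun a _ => bound a)) _.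
rewrite !big_split -!big_distrr sumr_const card_ord /= -(sum_gM_TT acm iI M_asi Eo).
rewrite -(parseval N_gssf Ef) -(etaM_gM acm iI M_asi) (etaM_xiM acm iI M_asi).
rewrite -[c *+ _]mulr_natr natrM -[m.+1%:R]natr1 cE -subr_ge0.
rewrite [leRHS](_ : _ = m%:R * m%:R + m%:R); last by ring.
by rewrite addr_ge0// mulr_ge0.
Qed.
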